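(* Let $U\subset\mathbb{R}^3$ be open with coordinates $x^1,x^2,x^3$, small enough (e.g. an open box) that functions with vanishing $x^1$-derivative may be regarded as functions of $(x^2,x^3)$. Let $g$ be a Riemannian metric on $U$ with a $g$-orthonormal frame of the form $$e_1=\alpha\frac{\partial}{\partial x^1}+\beta\frac{\partial}{\partial x^2},\qquad e_2=\delta\frac{\partial}{\partial x^1}+\epsilon\frac{\partial}{\partial x^2}+\zeta\frac{\partial}{\partial x^3},\qquad e_3=\frac{\partial}{\partial x^1},$$ where $\alpha,\beta,\delta,\epsilon,\zeta$ are smooth functions on $U$ and $\beta\zeta\neq0$ everywhere. Then $\{e_1,e_2,e_3\}$ is a $\phi$-eigenbasis of a contact metric structure $(g,\eta,\xi,\phi)$ on $U$ if and only if $\alpha,\beta,\zeta$ are functions of $(x^2,x^3)$ only, there is a smooth function $F=F(x^2,x^3)$ with $$\delta=\frac{\alpha\epsilon}{\beta}+F,$$ and $$F\zeta_2+\Bigl(\frac{\alpha}{\beta}\Bigr)_3\zeta^2-\Bigl(F_2-\frac{2}{\beta}\Bigr)\zeta=0,$$ where a subscript $i$ on a function denotes $\partial/\partial x^i$. At points where $F=0$ the last equation reads $\bigl(\frac{\alpha}{\beta}\bigr)_3\zeta=F_2-\frac{2}{\beta}$; where $F\neq0$ it is a Riccati equation in $x^2$ (with $x^3$ as parameter), whose solution is, locally, $$\zeta=F\,\frac{e^{-2\int\frac{dx^2}{\beta F}}}{\int e^{-2\int\frac{dx^2}{\beta F}}\bigl(\frac{\alpha}{\beta}\bigr)_3\,dx^2-K(x^3)}$$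 for a smooth function $K(x^3)$. In this case the associated metric is given in these coordinates by $$g=\begin{bmatrix}1&-\frac{\alpha}{\beta}&-\frac{F}{\zeta}\\[2pt]-\frac{\alpha}{\beta}&\frac{1+\alpha^2}{\beta^2}&\frac{\alpha\beta F-\epsilon}{\beta^2\zeta}\\[2pt]-\frac{F}{\zeta}&\frac{\alpha\beta F-\epsilon}{\beta^2\zeta}&\frac{\beta^2(1+F^2)+\epsilon^2}{\beta^2\zeta^2}\end{bmatrix},\qquad \det g=\frac{1}{\beta^2\zeta^2}.$$
   Context: A contact metric structure $(g,\eta,\xi,\phi)$ on a 3-manifold consists of a Riemannian metric $g$ (called an associated metric of $\eta$), a $1$-form $\eta$ with $\eta\wedge d\eta\neq 0$ everywhere, a vector field $\xi$ with $\eta(\xi)=1$ and $d\eta(\xi,\cdot)=0$, and a $(1,1)$-tensor field $\phi$, such that $\phi^2=-I+\eta\otimes\xi$, $\eta(X)=g(X,\xi)$ and $d\eta(X,Y)=g(X,\phi Y)$ for all vector fields $X,Y$, where the convention is $d\eta(X,Y)=\frac12\bigl(X\eta(Y)-Y\eta(X)-\eta([X,Y])\bigr)$. Set $h=\frac12\mathcal{L}_\xi\phi$ ($\mathcal L$ the Lie derivative). An ordered frame $\{e_1,e_2,e_3\}$ is a $\phi$-eigenbasis of the structure if it is orthonormal, $e_3=\xi$, $e_2=\phi e_1$, and $he_1=\lambda e_1$, $he_2=-\lambda e_2$ for some function $\lambda$. Coordinates in which the frame has the form displayed in the claim are called simplifying coordinates. The symbols $\int\cdots dx^2$ denote antiderivatives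 in $x^2$ with $x^3$ held fixed (the same antiderivative of $\frac{1}{\beta F}$ being used in both places). *)

(* Defs.v *)
From HB Require Import structures.
From mathcomp Require Import all_boot all_order all_algebra.
From mathcomp Require Import all_classical all_reals all_analysis.

Set Implicit Arguments.
Unset Strict Implicit.
Unset Printing Implicit Defensive.

Import Order.TTheory GRing.Theory Num.Theory numFieldNormedType.Exports.
Local Open Scope classical_set_scope.
Local Open Scope ring_scope.

(* Points and tangent vectors are row vectors in 'rV[R]_3.  A (1,1)-tensor at a
   point is a matrix acting on tangent vectors from the right, v |-> v *m A, and
   a covector is a column.  All fields are total functions on R^3 of which only
   the values on the open set U matter. *)

Definition i1 : 'I_3 := @Ordinal 3 0 isT.
Definition i2 : 'I_3 := @Ordinal 3 1 isT.
Definition i3 : 'I_3 := @Ordinal 3 2 isT.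

Section Calculus.
Variable R : realType.
Local Notation pt := 'rV[R]_3.
Implicit Types (U V : set pt) (f : pt -> R).

Definition coord_vec (i : 'I_3) : pt := delta_mx 0 i.

Definition partial (i : 'I_3) f : pt -> R := fun p => 'D_(coord_vec i) f p.

(* C^k on U (meant for open U). *)
Fixpoint Ck_on (k : nat) U f : Prop :=
  (forall p, U p -> {for p, continuous f}) /\
  match k with
  | 0%N => True
  | k'.+1 => forall i : 'I_3,
      (forall p, U p -> derivable f p (coord_vec i)) /\
      Ck_on k' U (partial i f)
  end.

Definition smooth_on U f : Prop := forall k, Ck_on k U f.

Definition smooth_mx_on (m n : nat) U (A : pt -> 'M[R]_(m, n)) : Prop :=
  forall i j, smooth_on U (fun p => A p i j).

Definition fun_of_x23 U f : Prop :=
  exists f0 : R -> R -> R, forall p, U p -> f p = f0 (p 0 i2) (p 0 i3).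

(* The standing "U is small enough" assumption; every open box satisfies it. *)
Definition x1_reducible U : Prop :=
  forall f, smooth_on U f -> (forall p, U p -> partial i1 f p = 0) ->
    fun_of_x23 U f.

Definition open_box (a b : pt) : set pt :=
  [set p | forall i, a 0 i < p 0 i < b 0 i].

(* P is (a choice of) the antiderivative of f in x^2, x^3 being held fixed. *)
Definition antiderivative_x2 V f (P : pt -> R) : Prop :=
  [/\ smooth_on V P, fun_of_x23 V P & forall p, V p -> partial i2 P p = f p].

End Calculus.

Section ContactMetric.
Variable R : realType.
Local Notation pt := 'rV[R]_3.
Local Notation vfield := (pt -> 'rV[R]_3).
Local Notation oneform := (pt -> 'cV[R]_3).
Local Notation tensor11 := (pt -> 'M[R]_3).
Local Notation metric := (pt -> 'M[R]_3).
Implicit Types (U : set pt) (X Y Z xi : vfield) (eta : oneform)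
  (phi : tensor11) (g : metric).

(* X(f) = X^i df/dx^i. *)
Definition vf_apply X (f : pt -> R) : pt -> R :=
  fun p => \sum_i X p 0 i * partial i f p.

Definition lie_bracket X Y : vfield := fun p =>
  \row_i (vf_apply X (fun q => Y q 0 i) p - vf_apply Y (fun q => X q 0 i) p).

Definition form_apply eta X : pt -> R := fun p => (X p *m eta p) 0 0.

Definition tensor_apply phi X : vfield := fun p => X p *m phi p.

Definition inner g X Y : pt -> R := fun p => (X p *m g p *m (Y p)^T) 0 0.

Definition d_form eta X Y : pt -> R := fun p =>
  2^-1 * (vf_apply X (form_apply eta Y) p - vf_apply Y (form_apply eta X) p
          - form_apply eta (lie_bracket X Y) p).

(* The factor 1/3 goes with the factor 1/2 in d_form. *)
Definition wedge_d_form eta X Y Z : pt -> R := fun p =>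
  3^-1 * (form_apply eta X p * d_form eta Y Z p
          + form_apply eta Y p * d_form eta Z X p
          + form_apply eta Z p * d_form eta X Y p).

Definition riemannian_on U g : Prop :=
  smooth_mx_on U g /\
  forall p, U p -> (g p)^T = g p /\
    forall v : 'rV[R]_3, v != 0 -> 0 < (v *m g p *m v^T) 0 0.

(* In cms_phi_square, v *m (eta p *m xi p) = eta(v) xi. *)
Record contact_metric_structure U g eta xi phi : Prop := {
  cms_riemannian : riemannian_on U g;
  cms_eta_smooth : smooth_mx_on U eta;
  cms_xi_smooth : smooth_mx_on U xi;
  cms_phi_smooth : smooth_mx_on U phi;
  cms_contact : forall p, U p -> exists X Y Z,
    [/\ smooth_mx_on U X, smooth_mx_on U Y, smooth_mx_on U Z &
        wedge_d_form eta X Y Z p != 0];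
  cms_eta_xi : forall p, U p -> form_apply eta xi p = 1;
  cms_deta_xi : forall X, smooth_mx_on U X ->
    forall p, U p -> d_form eta xi X p = 0;
  cms_phi_square : forall p, U p ->
    phi p *m phi p = - 1%:M + eta p *m xi p;
  cms_eta_metric : forall X, smooth_mx_on U X ->
    forall p, U p -> form_apply eta X p = inner g X xi p;
  cms_deta_metric : forall X Y, smooth_mx_on U X -> smooth_mx_on U Y ->
    forall p, U p -> d_form eta X Y p = inner g X (tensor_apply phi Y) p }.

(* (L_xi phi)(X) = [xi, phi X] - phi [xi, X]. *)
Definition lie_derivative xi phi X : vfield := fun p =>
  lie_bracket xi (tensor_apply phi X) p
  - tensor_apply phi (lie_bracket xi X) p.

Definition h_tensor xi phi X : vfield :=
  fun p => 2^-1 *: lie_derivative xi phi X p.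

Definition orthonormal_on U g X Y Z : Prop := forall p, U p ->
  [/\ inner g X X p = 1, inner g Y Y p = 1 & inner g Z Z p = 1] /\
  [/\ inner g X Y p = 0, inner g X Z p = 0 & inner g Y Z p = 0].

Definition phi_eigenbasis U g xi phi (e1 e2 e3 : vfield) : Prop :=
  [/\ orthonormal_on U g e1 e2 e3,
      (forall p, U p -> e3 p = xi p),
      (forall p, U p -> e2 p = tensor_apply phi e1 p) &
      exists lam : pt -> R, forall p, U p ->
        h_tensor xi phi e1 p = lam p *: e1 p /\
        h_tensor xi phi e2 p = - lam p *: e2 p].

End ContactMetric.

Section SimplifyingCoordinates.
Variable R : realType.
Local Notation pt := 'rV[R]_3.
Implicit Types alpha beta delta epsilon zeta F : pt -> R.

Definition frame1 alpha beta : pt -> 'rV[R]_3 :=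
  fun p => alpha p *: coord_vec R i1 + beta p *: coord_vec R i2.

Definition frame2 delta epsilon zeta : pt -> 'rV[R]_3 :=
  fun p => delta p *: coord_vec R i1 + epsilon p *: coord_vec R i2
           + zeta p *: coord_vec R i3.

Definition frame3 : pt -> 'rV[R]_3 := fun=> coord_vec R i1.

(* (alpha/beta)_3 *)
Definition ratio_3 alpha beta : pt -> R :=
  partial i3 (fun q => alpha q / beta q).

Definition frame_eq alpha beta zeta F (p : pt) : Prop :=
  F p * partial i2 zeta p + ratio_3 alpha beta p * zeta p ^+ 2
  - (partial i2 F p - 2 / beta p) * zeta p = 0.

Definition assoc_metric alpha beta epsilon zeta F (p : pt) : 'M[R]_3 :=
  let a := alpha p in let b := beta p in let e := epsilon p in
  let z := zeta p in let f := F p in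
  \matrix_(i, j) nth 0 (nth [::]
    [:: [:: 1;         - (a / b);                         - (f / z)];
        [:: - (a / b); (1 + a ^+ 2) / b ^+ 2;             (a * b * f - e) / (b ^+ 2 * z)];
        [:: - (f / z); (a * b * f - e) / (b ^+ 2 * z);
                       (b ^+ 2 * (1 + f ^+ 2) + e ^+ 2) / (b ^+ 2 * z ^+ 2)]]
    i) j.

End SimplifyingCoordinates.

(* Main.v *)
Require Import Defs.
From mathcomp Require Import all_boot all_order all_algebra.
From mathcomp Require Import all_classical all_reals all_analysis.
From mathcomp Require Import ring lra.
Import Order.TTheory GRing.Theory Num.Theory numFieldNormedType.Exports.
Local Open Scope classical_set_scope.
Local Open Scope ring_scope.

(* Write eta = dx1 + p dx2 + q dx3, as eta(d/dx1) = 1.  The condition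
   d eta(xi, .) = 0 says that p and q depend on (x2, x3) only, and
   eta(e1) = eta(e2) = 0 says p = - alpha / beta and q = - F / zeta with
   F = delta - alpha epsilon / beta.  The condition d eta(e1, e2) = -1 becomes
   (q_2 - p_3) beta zeta = -2, which is the displayed equation and also shows
   that beta zeta does not depend on x1; together with the x3-component of
   h e1 = lambda e1, which is beta zeta_1 = zeta beta_1, this makes beta, zeta
   and then alpha independent of x1.  Conversely these data define eta and phi
   by explicit formulas.

   Where F <> 0, the substitution w = F / zeta makes the equation linear, with
   integrating factor exp (- 2 P).  Smooth antiderivatives in x2 are obtained
   from one-variable ones by the mean value theorem and compactness. *)

(** * Smooth functions *)

(** Origin of the constant: [phi] squares to -1 on the kernel of eta, so phi e2 = - e1 and d eta(e1,
    e2) = g(e1, phi e2) = -1; the factor 1/2 in [d_form] turns this into -2, whence 2 / beta in the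
    equation. In the x1-direction this controls only the product beta zeta. The eigenvector
    condition says that the ratio zeta / beta is constant along x1 as well, and the two together
    force both derivatives to vanish. [epsilon] may still depend on x1, and lambda = epsilon_1 / (2
    beta) measures how it does.

    The analytic obstacle is the smoothness of antiderivatives in x3: integrating line by line
    leaves neighbouring lines unrelated. Vanishing on a slice x2 = c determines the antiderivative,
    and its derivative in another direction is then the antiderivative, vanishing on the same slice,
    of the differentiated integrand. Smoothness follows by induction on the order. *)

Section SmoothFunctions.
Set Implicit Arguments.
Unset Strict Implicit.
Variable R : realType.
Local Notation pt := 'rV[R]_3.
Implicit Types (U V : set pt) (f g : pt -> R) (p q : pt) (i : 'I_3).

Lemma near_open U p (P : pt -> Prop) : open U -> U p ->
  (forall q, U q -> P q) -> \near p, P p.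
Proof. by move=> oU Up UP; apply: filterS (open_nbhs_nbhs (conj oU Up)). Qed.

Lemma partial_eq_on U f g i p : open U -> (forall q, U q -> f q = g q) ->
  U p -> partial i f p = partial i g p.
Proof. by move=> oU fg Up; apply: near_eq_derive; exact: near_open fg. Qed.

(** Values off [U] are arbitrary; openness of [U] turns agreement on [U] into agreement near each of
    its points, which passes to all derivatives. The closure lemmas below use this to replace a
    partial derivative by its formula. *)
Lemma Ck_on_eq k U f g : open U -> (forall p, U p -> f p = g p) ->
  Ck_on k U f -> Ck_on k U g.
Proof.
move=> oU.
have cfg f1 g1 : (forall p, U p -> f1 p = g1 p) ->
    (forall p, U p -> {for p, continuous f1}) ->
    forall p, U p -> {for p, continuous g1}.
  move=> fg1 cf p Up.
  have e : \near p, f1 p = g1 p by exact: near_open fg1.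
  have cfp : f1 x @[x --> p] --> f1 p by exact: cf.
  suff : g1 x @[x --> p] --> g1 p by [].
  rewrite -(fg1 p Up).
  by apply: cvg_trans cfp; exact: (near_eq_cvg e).
elim: k f g => [|k IH] f g fg [cf df]; split; [exact: cfg fg cf|by []|exact: cfg fg cf|].
move=> i; have [dfi Cfi] := df i; split.
  by move=> p Up; apply: near_eq_derivable (dfi p Up); exact: near_open fg.
by apply: IH Cfi => p Up; exact: partial_eq_on fg Up.
Qed.

Lemma Ck_onS k U f : Ck_on k.+1 U f -> Ck_on k U f.
Proof.
elim: k f => [|k IH] f [cf df]; first by split.
by split => // i; have [? ?] := df i; split => //; exact: IH.
Qed.

Lemma Ck_on_sub k U V f : V `<=` U -> Ck_on k U f -> Ck_on k V f.
Proof.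
move=> VU; elim: k f => [|k IH] f [cf df]; split=> //.
- by move=> p /VU; exact: cf.
- by move=> p /VU; exact: cf.
- move=> i; have [dfi Cfi] := df i; split; last exact: IH.
  by move=> p /VU; exact: dfi.
Qed.

Lemma Ck_on_cst k U (c : R) : Ck_on k U (fun=> c).
Proof.
elim: k c => [|k IH] c; split=> //; [move=> p _; apply: cst_continuous|move=> p _; apply: cst_continuous|].
move=> i; split; first by move=> p _; exact: derivable_cst.
have -> : partial i (fun=> c) = (fun=> 0) :> (pt -> R).
  by apply/funext => p; exact: derive_cst.
exact: IH.
Qed.

Lemma Ck_onD k U f g : open U -> Ck_on k U f -> Ck_on k U g ->
  Ck_on k U (fun p => f p + g p).
Proof.
move=> oU; elim: k f g => [|k IH] f g [cf df] [cg dg]; split=> //;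
  try by move=> p Up; exact: (continuousD (cf p Up) (cg p Up)).
move=> i; have [dfi Cfi] := df i; have [dgi Cgi] := dg i; split.
  by move=> p Up; exact: (derivableD (dfi p Up) (dgi p Up)).
apply: (@Ck_on_eq _ _ (fun p => partial i f p + partial i g p)) => //.
  by move=> p Up; rewrite /partial (deriveD (dfi p Up) (dgi p Up)).
exact: IH.
Qed.

Lemma Ck_onM k U f g : open U -> Ck_on k U f -> Ck_on k U g ->
  Ck_on k U (fun p => f p * g p).
Proof.
move=> oU; elim: k f g => [|k IH] f g Cf Cg; have [cf df] := Cf;
  have [cg dg] := Cg; split=> //;
  try by move=> p Up; exact: (continuousM (cf p Up) (cg p Up)).
move=> i; have [dfi Cfi] := df i; have [dgi Cgi] := dg i; split.
  by move=> p Up; exact: (derivableM (dfi p Up) (dgi p Up)).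
apply: (@Ck_on_eq _ _ (fun p => f p * partial i g p + g p * partial i f p)) => //.
  by move=> p Up; rewrite /partial (deriveM (dfi p Up) (dgi p Up)).
by apply: Ck_onD => //; apply: IH => //; exact: Ck_onS.
Qed.

Lemma Ck_onN k U f : open U -> Ck_on k U f -> Ck_on k U (fun p => - f p).
Proof.
move=> oU Cf; apply: (@Ck_on_eq _ _ (fun p => (-1) * f p)) => //.
  by move=> p _; rewrite mulN1r.
by apply: Ck_onM => //; exact: Ck_on_cst.
Qed.

(** The induction closes because the derivative of 1/f is a polynomial in 1/f and the derivative of
    f. *)
Lemma Ck_onV k U f : open U -> (forall p, U p -> f p != 0) -> Ck_on k U f ->
  Ck_on k U (fun p => (f p)^-1).
Proof.
move=> oU f0; elim: k => [|k IH] Cf; have [cf df] := Cf; split=> //;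
  try by move=> p Up; apply: continuousV (cf p Up); exact: f0.
move=> i; have [dfi Cfi] := df i; split.
  by move=> p Up; apply: derivableV (dfi p Up); exact: f0.
apply: (@Ck_on_eq _ _ (fun p => - ((f p)^-1 * (f p)^-1) * partial i f p)) => //.
  move=> p Up; rewrite /partial deriveV ?f0//; last exact: dfi.
  by rewrite -expr2 exprVn.
apply: Ck_onM => //; apply: Ck_onN => //.
by apply: Ck_onM => //; apply: IH; exact: Ck_onS.
Qed.

(** Only a directional derivative of [f] is given, so the chain rule for differentiable maps does
    not apply at [p]. On the line through [p] there is one real variable, where derivability and
    differentiability coincide. *)
Lemma is_derive_expR_comp f i p : derivable f p (coord_vec R i) ->
  is_derive p (coord_vec R i) (fun q => expR (f q))
    (expR (f p) * partial i f p).
Proof.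
move=> dfp; pose v := coord_vec R i; pose fl (h : R) := f (h *: v + p).
have dfl : derivable fl 0 1 by move/derivable1P : dfp.
have flE : fl 0 = f p by rewrite /fl scale0r add0r.
have line (u : pt -> R) : 'D_v u p = 'D_1 (fun h : R => u (h *: v + p)) 0.
  rewrite /derive; set g1 := fun h => h^-1 *: _; set g2 := fun h => h^-1 *: _.
  suff -> : g1 = g2 by [].
  by apply/funext => h; rewrite /g1 /g2 /= addr0 scale0r add0r [_%:A]mulr1.
split.
  apply/derivable1P; apply/derivable1_diffP.
  apply: (@differentiable_comp _ _ _ _ fl (@expR R)).
    exact/derivable1_diffP.
  exact/derivable1_diffP/derivable_expR.
rewrite /partial line [in RHS]line -!derive1E.
have -> : (fun h : R => expR (f (h *: v + p))) = (@expR R) \o fl by [].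
rewrite derive1_comp; [|exact: dfl|exact: derivable_expR].
have -> : expR^`()%classic (fl 0) = expR (f p).
  by rewrite derive1E derive_val flE.
by [].
Qed.

Lemma Ck_on_expR k U f : open U -> Ck_on k U f ->
  Ck_on k U (fun p => expR (f p)).
Proof.
move=> oU; elim: k => [|k IH] Cf; have [cf df] := Cf; split=> //;
  try by move=> p Up; apply: continuous_comp (cf p Up) _; exact: continuous_expR.
move=> i; have [dfi Cfi] := df i; split.
  by move=> p Up; have [] := is_derive_expR_comp (dfi p Up).
apply: (@Ck_on_eq _ _ (fun p => expR (f p) * partial i f p)) => //.
  by move=> p Up; have [_ <-] := is_derive_expR_comp (dfi p Up).
by apply: Ck_onM => //; apply: IH; exact: Ck_onS.
Qed.

Lemma smooth_on_eq U f g : open U -> (forall p, U p -> f p = g p) ->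
  smooth_on U f -> smooth_on U g.
Proof. by move=> oU fg sf k; exact: Ck_on_eq (sf k). Qed.

Lemma smooth_on_sub U V f : V `<=` U -> smooth_on U f -> smooth_on V f.
Proof. by move=> VU sf k; exact: Ck_on_sub (sf k). Qed.

Lemma smooth_on_cst U (c : R) : smooth_on U (fun=> c).
Proof. by move=> k; exact: Ck_on_cst. Qed.

Lemma smooth_onD U f g : open U -> smooth_on U f -> smooth_on U g ->
  smooth_on U (fun p => f p + g p).
Proof. by move=> oU sf sg k; exact: Ck_onD. Qed.

Lemma smooth_onN U f : open U -> smooth_on U f -> smooth_on U (fun p => - f p).
Proof. by move=> oU sf k; exact: Ck_onN. Qed.

Lemma smooth_onB U f g : open U -> smooth_on U f -> smooth_on U g ->
  smooth_on U (fun p => f p - g p).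
Proof. by move=> oU sf sg; apply: smooth_onD => //; exact: smooth_onN. Qed.

Lemma smooth_onM U f g : open U -> smooth_on U f -> smooth_on U g ->
  smooth_on U (fun p => f p * g p).
Proof. by move=> oU sf sg k; exact: Ck_onM. Qed.

Lemma smooth_onV U f : open U -> (forall p, U p -> f p != 0) ->
  smooth_on U f -> smooth_on U (fun p => (f p)^-1).
Proof. by move=> oU f0 sf k; exact: Ck_onV. Qed.

Lemma smooth_on_div U f g : open U -> (forall p, U p -> g p != 0) ->
  smooth_on U f -> smooth_on U g -> smooth_on U (fun p => f p / g p).
Proof. by move=> oU g0 sf sg; apply: smooth_onM => //; exact: smooth_onV. Qed.

Lemma smooth_on_expR U f : open U -> smooth_on U f ->
  smooth_on U (fun p => expR (f p)).
Proof. by move=> oU sf k; exact: Ck_on_expR. Qed.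

Lemma smooth_on_partial U f i : smooth_on U f -> smooth_on U (partial i f).
Proof. by move=> sf k; have [_ /(_ i)[]] := sf k.+1. Qed.

Lemma smooth_on_continuous U f p : smooth_on U f -> U p ->
  {for p, continuous f}.
Proof. by move=> sf; have [+ _] := sf 0%N; exact. Qed.

Lemma smooth_on_derivable U f p i : smooth_on U f -> U p ->
  derivable f p (coord_vec R i).
Proof. by move=> sf Up; have [_ /(_ i)[+ _]] := sf 1%N; exact. Qed.

Lemma partialD U f g i p : smooth_on U f -> smooth_on U g -> U p ->
  partial i (fun q => f q + g q) p = partial i f p + partial i g p.
Proof.
by move=> sf sg Up; rewrite /partial (deriveD (smooth_on_derivable sf Up)
  (smooth_on_derivable sg Up)).
Qed.

Lemma partialN U f i p : smooth_on U f -> U p ->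
  partial i (fun q => - f q) p = - partial i f p.
Proof. by move=> sf Up; rewrite /partial (deriveN (smooth_on_derivable sf Up)). Qed.

Lemma partialM U f g i p : smooth_on U f -> smooth_on U g -> U p ->
  partial i (fun q => f q * g q) p = f p * partial i g p + g p * partial i f p.
Proof.
by move=> sf sg Up; rewrite /partial (deriveM (smooth_on_derivable sf Up)
  (smooth_on_derivable sg Up)).
Qed.

Lemma partialV U f i p : smooth_on U f -> U p -> f p != 0 ->
  partial i (fun q => (f q)^-1) p = - (partial i f p / f p ^+ 2).
Proof.
move=> sf Up f0; rewrite {1}/partial.
rewrite (deriveV f0 (smooth_on_derivable sf Up)).
by rewrite -[_ *: _]/(_ * _) mulNr mulrC.
Qed.

Lemma partial_div U f g i p : open U -> smooth_on U f -> smooth_on U g ->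
  (forall q, U q -> g q != 0) -> U p ->
  partial i (fun q => f q / g q) p =
  (partial i f p * g p - f p * partial i g p) / g p ^+ 2.
Proof.
move=> oU sf sg g0 Up; rewrite (@partialM U) //; last exact: smooth_onV.
rewrite (@partialV U) ?g0//; have := g0 _ Up => ?; field.
by [].
Qed.

Lemma partial_expR U f i p : smooth_on U f -> U p ->
  partial i (fun q => expR (f q)) p = expR (f p) * partial i f p.
Proof.
move=> sf Up.
by have [_ <-] := is_derive_expR_comp (smooth_on_derivable (i := i) sf Up).
Qed.

Lemma partial_cst i (c : R) p : partial i (fun=> c) p = 0.
Proof. exact: derive_cst. Qed.

Lemma partial_shift f i p (v : pt) :
  partial i (fun q => f (q + v)) p = partial i f (p + v).
Proof.
rewrite /partial /derive; set g1 := fun h => h^-1 *: _.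
set g2 := fun h => h^-1 *: _; suff -> : g1 = g2 by [].
by apply/funext => h; rewrite /g1 /g2 /= addrA.
Qed.

(* Two points of [U] with the same [x2], [x3] differ by a translation along
   [x1], which preserves [f] near them. *)
Lemma fun_of_x23_partial U f i : open U -> fun_of_x23 U f ->
  fun_of_x23 U (partial i f).
Proof.
move=> oU [f0 ff0].
have H p q : U p -> U q -> p 0 i2 = q 0 i2 -> p 0 i3 = q 0 i3 ->
    partial i f p = partial i f q.
  move=> Up Uq e2 e3; pose v := q - p.
  have -> : q = p + v by rewrite /v addrC subrK.
  rewrite -partial_shift; apply: near_eq_derive.
  have nU : \near p, U p by exact: open_nbhs_nbhs.
  have nV : \forall x \near p, U (x + v).
    have cv : {for p, continuous (fun x : pt => x + v)}.
      by apply: continuousD => //; exact: cst_continuous.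
    apply: cv; apply: open_nbhs_nbhs; split => //.
    by rewrite /v addrC subrK.
  near=> x; rewrite !ff0; [|by near: x..].
  by rewrite !mxE e2 e3 !subrr !addr0.
pose fiber s t : set pt := [set q | [/\ U q, q 0 i2 = s & q 0 i3 = t]].
exists (fun s t => partial i f (xget 0 (fiber s t))) => p Up.
have [] : fiber (p 0 i2) (p 0 i3) (xget 0 (fiber (p 0 i2) (p 0 i3))).
  by apply: xgetPex; exists p.
move=> ? e2 e3.
exact: H.
Unshelve. all: by end_near. Qed.

(** Openness keeps h e1 + p in [U] for small h, where [f] has its value at [p]; the difference
    quotients vanish near h = 0. *)
Lemma fun_of_x23_partial1 U f p : open U -> fun_of_x23 U f -> U p ->
  partial i1 f p = 0.
Proof.
move=> oU [f0 ff0] Up; rewrite /partial /derive.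
apply: lim_near_cst => //.
have nU : \forall h \near (0 : R), U (h *: coord_vec R i1 + p).
  have cv : {for (0 : R), continuous (fun h : R => h *: coord_vec R i1 + p)}.
    by apply: continuousD; [exact: scalel_continuous|exact: cst_continuous].
  apply: cv; apply: open_nbhs_nbhs; split => //.
  by rewrite scale0r add0r.
apply: (@cvg_within _ (nbhs (0 : R))).
near=> h => /=; rewrite !ff0//; last by near: h.
by rewrite !mxE /= !mulr0 !add0r subrr scaler0.
Unshelve. all: by end_near. Qed.

End SmoothFunctions.

(** * Antiderivatives depending smoothly on parameters *)

Section MeanValue.
Set Implicit Arguments.
Unset Strict Implicit.
Variables (R : realType) (V : normedModType R).
Implicit Types (p v : V) (f d : V -> R).

Lemma is_derive_lineP f p v (x : R) :
  is_derive p v f x <-> is_derive (0 : R) 1 (fun h : R => f (p + h *: v)) x.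
Proof.
pose g (h : R) := f (p + h *: v).
have E : (fun h : R => h^-1 *: (f (h *: v + p) - f p)) =
  (fun h : R => h^-1 *: (g (h *: (1 : R) + 0) - g 0)).
  by apply/funext => h; rewrite /g scale0r !addr0 [_%:A]mulr1 [h *: v + p]addrC.
by split => -[df <-]; split; move: df; rewrite /derivable /derive /= E.
Qed.

Lemma is_derive_line f p v (s t x : R) :
  is_derive (p + (t * s) *: v) v f x ->
  is_derive t 1 (fun r : R => f (p + (r * s) *: v)) (s * x).
Proof.
move=> /is_derive_lineP H.
have e : (fun h : R => f (p + (h * s) *: v)) =
    (fun h : R => f (p + (t * s) *: v + h *: v)) \o (fun h => (h - t) * s).
  by apply/funext => h; rewrite /= -addrA -scalerDl -mulrDl [t + _]addrC subrK.
rewrite e [s * x]mulrC.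
have lin : is_derive t 1 (fun h : R => (h - t) * s) s.
  have -> : (fun h : R => (h - t) * s) = s *: (id - cst t).
    by apply/funext => h; rewrite mulrC.
  by apply: is_derive_eq; rewrite subr0; exact: mulr1.
apply: is_derive1_comp.
by rewrite subrr mul0r.
Qed.

(** The parameter t runs over [0, 1], so that [s] may have either sign or be zero. Derivatives are
    asked for along [v] only, since [Ck_on] records nothing but directional derivatives. *)
Lemma mean_value f d p v (s : R) :
  (forall t : R, 0 <= t <= 1 ->
    is_derive (p + (t * s) *: v) v f (d (p + (t * s) *: v))) ->
  exists2 t : R, 0 <= t <= 1 & f (p + s *: v) - f p = s * d (p + (t * s) *: v).
Proof.
move=> H.
pose u (t : R) := f (p + (t * s) *: v).
pose du (t : R) := s * d (p + (t * s) *: v).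
have Hu (t : R) : 0 <= t <= 1 -> is_derive t 1 u (du t).
  by move=> ht; apply: is_derive_line; exact: H.
have [|||t ht e] := @MVT_segment R u du 0 1; first exact: ler01.
- move=> t; rewrite in_itv /= => /andP[t0 t1]; apply: Hu.
  by rewrite !ltW.
- apply: derivable_within_continuous => t; rewrite in_itv /= => ht.
  by have [] := Hu t ht.
exists t; first by move: ht; rewrite in_itv.
by move: e; rewrite /u /du subr0 mulr1 mul1r mul0r scale0r addr0.
Qed.

Lemma constant_along f p v (s : R) :
  (forall t : R, 0 <= t <= 1 -> is_derive (p + (t * s) *: v) v f 0) ->
  f (p + s *: v) = f p.
Proof.
move=> H; have [t _] := mean_value (d := fun=> 0) H.
by rewrite mulr0 => /eqP; rewrite subr_eq0 => /eqP.
Qed.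

End MeanValue.

(** * Antiderivatives of continuous functions on an open interval *)

Section Antiderivative1.
Set Implicit Arguments.
Unset Strict Implicit.
Variable R : realType.
Local Notation mu := (@lebesgue_measure R).
Implicit Types (u G : R -> R).

Lemma antiderivative_unique u G1 G2 (c s : R) :
  (forall r : R, Num.min c s <= r <= Num.max c s ->
    is_derive r 1 G1 (u r) /\ is_derive r 1 G2 (u r)) ->
  G1 c = G2 c -> G1 s = G2 s.
Proof.
move=> H e.
suff : G1 s - G2 s = G1 c - G2 c by rewrite e subrr => /eqP; rewrite subr_eq0 => /eqP.
have := @constant_along R R^o (fun r => G1 r - G2 r) c 1 (s - c).
rewrite /= [_ *: _]mulr1 [c + _]addrC subrK; apply=> t /andP[t0 t1].
rewrite [_ *: _]mulr1.
have [|D1 D2] := H (c + t * (s - c)).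
  by case: (leP c s) => cs; apply/andP; split; nra.
by rewrite -[X in is_derive _ _ _ X](subrr (u (c + t * (s - c)))); exact: is_deriveB.
Qed.

(** Continuity up to both endpoints gives integrability, hence the fundamental theorem of calculus.
    Subtracting the value at [c] makes primitives from different segments comparable. *)
Lemma antiderivative_subsegment u (x c y : R) : x < c < y ->
  (forall r : R, x <= r <= y -> {for r, continuous u}) ->
  exists2 G, G c = 0 & forall r : R, x < r < y -> is_derive r 1 G (u r).
Proof.
move=> /andP[xc cy] cu.
have iu : mu.-integrable `[x, y] (EFin \o u).
  apply: continuous_compact_integrable; first exact: segment_compact.
  apply: continuous_in_subspaceT => r; rewrite inE /= in_itv /= => ?; exact: cu.
pose G0 (s : R) := (\int[mu]_(t in `[x, s]) (u t))%R.
exists (fun s => G0 s - G0 c); first by rewrite subrr.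
move=> r /andP[xr ry].
have [|dG eG] := continuous_FTC1_closed ry iu xr.
  by apply: cu; rewrite !ltW.
rewrite -[u r]subr0; apply: is_deriveB.
by split; [exact: dG|rewrite -derive1E; exact: eG].
Qed.

(* On a compact segment this is the fundamental theorem of calculus; the value
   at [s] is taken from a segment around [c] and [s], and by uniqueness one
   choice of segment serves a whole neighbourhood of [s]. *)
Lemma antiderivative_exists u (x c y : R) : x < c < y ->
  (forall r : R, x < r < y -> {for r, continuous u}) ->
  exists2 G, G c = 0 & forall r : R, x < r < y -> is_derive r 1 G (u r).
Proof.
move=> /andP[xc cy] cu.
(* Midpoints between the ends of the interval and the pair [c], [s]: the segment from [l s] to [h s]
   stays inside (x, y) and has both [c] and [s] in its interior. *)
pose l s : R := (x + Num.min c s) / 2.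
pose h s : R := (y + Num.max c s) / 2.
have lh s : x < s < y -> [/\ x < l s, l s < c, l s < s, c < h s & s < h s] /\ h s < y.
  move=> /andP[xs sy]; rewrite /l /h.
  by case: (leP c s) => cs; split; [split|..|split|]; lra.
have H s : exists G, x < s < y -> G c = 0 /\
    forall r : R, l s < r < h s -> is_derive r 1 G (u r).
  have [xsy|] := boolP (x < s < y); last by exists (fun=> 0).
  have [[xl lc ls ch sh] hy] := lh s xsy.
  have [| |G G0 GD] := @antiderivative_subsegment u (l s) c (h s).
  - by rewrite lc ch.
  - by move=> r /andP[lr rh]; apply: cu; rewrite (lt_le_trans xl)//= (le_lt_trans rh).
  by exists G.
have [G GP] := choice H.
exists (fun s => G s s); first by have [|] := GP c; rewrite ?xc.
move=> s xsy; have [[xl lc ls ch sh] hy] := lh s xsy.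
have [G0 GD] := GP s xsy.
apply: (@near_eq_is_derive R R^o R^o (G s)); last by apply: GD; rewrite ls sh.
near=> r.
have lr : l s < r by near: r; exact: lt_nbhsr.
have rh : r < h s by near: r; exact: lt_nbhsl.
have xry : x < r < y by rewrite (lt_trans xl)//= (lt_trans rh).
have [Gr0 GrD] := GP r xry.
have [[xl' lc' ls' ch' sh'] hy'] := lh r xry.
apply: (@antiderivative_unique u _ _ c); last by rewrite G0 Gr0.
move=> z; case: (leP c r) => cr /andP[z1 z2]; (split; [apply: GD|apply: GrD]); lra.
Unshelve. all: by end_near. Qed.

End Antiderivative1.

(** * Antiderivatives along x2 in an open box *)

Section BoxAntiderivative.
Set Implicit Arguments.
Unset Strict Implicit.
Variables (R : realType) (a b : 'rV[R]_3).
Local Notation pt := 'rV[R]_3.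
Local Notation e := (coord_vec R).
Local Notation V := (open_box a b).
Implicit Types (f P Q : pt -> R) (p q v : pt) (i j : 'I_3).

Lemma coord_vecE i j : e i 0 j = (j == i)%:R.
Proof. by rewrite mxE eqxx. Qed.

Lemma open_box_open : open V.
Proof.
suff H (p : pt) : V p -> \near p, V p by rewrite openE => p; exact: H.
move=> Vp.
apply: (@filter_forall pt _ (fun i q => a 0 i < q 0 i < b 0 i) (nbhs p)) => i.
have /andP[ai bi] := Vp i.
have c : {for p, continuous (fun q : pt => q 0 i)} by exact: coord_continuous.
have h1 : \forall q \near p, a 0 i < (q : pt) 0 i.
  exact: (c [set x | a 0 i < x] (lt_nbhsr ai)).
have h2 : \forall q \near p, (q : pt) 0 i < b 0 i.
  exact: (c [set x | x < b 0 i] (lt_nbhsl bi)).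
by apply: filterS2 h1 h2 => q ? ?; apply/andP.
Qed.

Lemma open_box_segment p v (t : R) : 0 <= t <= 1 -> V p -> V (p + v) ->
  V (p + t *: v).
Proof.
move=> /andP[t0 t1] Vp Vpv i; have /andP[l1 r1] := Vp i.
have := Vpv i; rewrite !mxE => /andP[l2 r2].
by have [y0|y0] := leP 0 (v 0 i); apply/andP; split; nra.
Qed.

Lemma open_box_line p i (s t : R) : 0 <= t <= 1 -> V p -> V (p + s *: e i) ->
  V (p + (t * s) *: e i).
Proof. by move=> t01 Vp Vs; rewrite -scalerA; exact: open_box_segment. Qed.

Lemma open_box_coord p i (s : R) : V p -> a 0 i < s < b 0 i ->
  V (p + (s - p 0 i) *: e i).
Proof.
move=> Vp hs j; rewrite !mxE eqxx /=.
have [->|ji] := eqVneq j i; first by rewrite mulr1 addrC subrK.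
by rewrite mulr0 addr0; exact: Vp.
Qed.

(** A tube argument: near each parameter both the shifted and the unshifted point lie within eps / 2
    of the same value of [f], and compactness of [0, 1] yields one neighbourhood of shifts that
    serves the whole segment. *)
Lemma uniform_on_line f p i (s eps : R) : 0 < eps ->
  (forall q, V q -> {for q, continuous f}) -> V p -> V (p + s *: e i) ->
  \forall v \near (0 : pt), forall t : R, 0 <= t <= 1 ->
    V (p + (t * s) *: e i + v) /\
    `|f (p + (t * s) *: e i + v) - f (p + (t * s) *: e i)| < eps.
Proof.
move=> e0 cf Vp Vs.
have /compact_near_coveringP K := @segment_compact R 0 1.
have := K pt (nbhs (0 : pt)) (fun v t =>
  V (p + (t * s) *: e i + v) /\
    `|f (p + (t * s) *: e i + v) - f (p + (t * s) *: e i)| < eps) _.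
move=> /(_ _) H.
have {}H := H _.
have e2 : 0 < eps / 2 by rewrite divr_gt0.
suff : \forall v \near (0 : pt), `[0, 1]%classic `<=` (fun t : R =>
  V (p + (t * s) *: e i + v) /\
    `|f (p + (t * s) *: e i + v) - f (p + (t * s) *: e i)| < eps).
  by apply: filterS => v h t t01; apply: h; rewrite /= in_itv.
apply: H => t; rewrite /= in_itv /= => t01.
have Vt := open_box_line t01 Vp Vs.
pose x := p + (t * s) *: e i.
have cl : (fun r : R => p + (r * s) *: e i) r @[r --> t] --> x.
  have c1 : {for t, continuous (fun r : R => r * s)}.
    by apply: continuousM; [exact: cvg_id|exact: cst_continuous].
  suff : {for t, continuous (fun r : R => p + (r * s) *: e i)} by [].
  apply: continuousD; first exact: cst_continuous.
  exact: continuous_comp c1 (@scalel_continuous _ _ _ _).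
pose W : set pt := [set y | V y /\ `|f x - f y| < eps / 2].
have nx : nbhs x W.
  rewrite -[nbhs x W]/(\forall y \near x, W y).
  near=> y; split; first by near: y; apply: open_nbhs_nbhs; split => //; exact: open_box_open.
  near: y; apply: cvgr_dist_lt => //; exact: cf.
have nx1 : \forall r \near t, W (p + (r * s) *: e i) by exact: (cl W nx).
have nx2 : \forall r \near t & v \near (0 : pt), W (p + (r * s) *: e i + v).
  have c2 : (fun rv : R * pt => p + (rv.1 * s) *: e i + rv.2) rv
       @[rv --> (t, (0 : pt))] --> x + 0.
    apply: cvgD; last exact: cvg_snd.
    exact: (cvg_comp (fst : R * pt -> R) _ cvg_fst cl).
  by rewrite addr0 in c2; exact: (c2 W nx).
have nx3 : \forall r \near t & v \near (0 : pt), W (p + (r * s) *: e i).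
  exact: (cvg_fst nx1).
move: nx2 nx3; apply: filterS2 => -[r v] /= [V2 h2] [V1 h1]; split => //.
move: h1 h2; rewrite !ltr_norml => /andP[? ?] /andP[? ?]; apply/andP; split; lra.
Unshelve. all: by end_near. Qed.

Lemma coord_le_norm v i : `|v 0 i| <= `|v|.
Proof.
rewrite [X in _ <= X]mx_normrE.
exact: (le_bigmax _ (fun j : 'I_1 * 'I_3 => `|v j.1 j.2|) (0, i)).
Qed.

Lemma is_derive_shift_arg f p v w (x : R) : is_derive (p + w) v f x ->
  is_derive p v (fun q => f (q + w)) x.
Proof.
move=> /is_derive_lineP H; apply/is_derive_lineP.
by have -> : (fun h : R => f (p + h *: v + w)) = (fun h => f (p + w + h *: v));
  [apply/funext => h; rewrite addrAC|].
Qed.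

Variable c : R.
Hypothesis c_in : a 0 i2 < c < b 0 i2.

(** The second clause fixes the constant of integration on all x2-lines at once; the first alone
    would let the constant vary arbitrarily with x1 and x3. *)
Definition based_antiderivative f P :=
  (forall p, V p -> is_derive p (e i2) P (f p)) /\
  (forall p, V p -> p 0 i2 = c -> P p = 0).

Let to_base p : pt := p + (c - p 0 i2) *: e i2.

Let to_base_in p : V p -> V (to_base p).
Proof. by move=> Vp; exact: open_box_coord. Qed.

Let to_base2 p : to_base p 0 i2 = c.
Proof. by rewrite !mxE !eqxx mulr1 addrC subrK. Qed.

(** Applied to combinations of translates of an antiderivative: they vanish at the base, so a
    uniform bound on their x2-derivative bounds them at [p]. *)
Lemma mean_value_from_base (D d : pt -> R) p :
  (forall t : R, 0 <= t <= 1 ->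
    is_derive (p + (t * (c - p 0 i2)) *: e i2) (e i2) D
      (d (p + (t * (c - p 0 i2)) *: e i2))) ->
  D (to_base p) = 0 ->
  exists2 t : R, 0 <= t <= 1 &
    D p = (p 0 i2 - c) * d (p + (t * (c - p 0 i2)) *: e i2).
Proof.
move=> H D0; have [t t01 E] := mean_value H; exists t => //.
by move: E; rewrite -/(to_base p) D0; lra.
Qed.

Lemma based_antiderivative_exists f :
  (forall p, V p -> {for p, continuous f}) -> exists P, based_antiderivative f P.
Proof.
move=> cf.
have H q : exists G : R -> R, V q -> G c = 0 /\
    forall s : R, a 0 i2 < s < b 0 i2 ->
      is_derive s 1 G (f (q + (s - q 0 i2) *: e i2)).
  have [Vq|] := pselect (V q); last by exists (fun=> 0).
  have [r hr|G G0 GD] := @antiderivative_exists R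
    (fun s => f (q + (s - q 0 i2) *: e i2)) _ _ _ c_in; last by exists G.
  have cl : {for r, continuous (fun s : R => q + (s - q 0 i2) *: e i2)}.
    apply: continuousD; first exact: cst_continuous.
    have c1 : {for r, continuous (fun s : R => s - q 0 i2)}.
      by apply: continuousD => //; exact: cst_continuous.
    exact: continuous_comp c1 (@scalel_continuous _ _ _ _).
  by apply: (continuous_comp cl); apply: cf; exact: open_box_coord.
have [G GP] := choice H.
(* The choice is made at the base point and not at [p], so all points of one x2-line share the same
   primitive and the derivative along the line makes sense. *)
exists (fun p => G (to_base p) (p 0 i2)); split => p Vp; last first.
  by move=> ->; have [] := GP (to_base p) (to_base_in Vp).
have [_ GD] := GP (to_base p) (to_base_in Vp).
apply/is_derive_lineP.
have -> : (fun h : R => G (to_base (p + h *: e i2)) ((p + h *: e i2) 0 i2)) =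
    G (to_base p) \o (fun h => p 0 i2 + h).
  apply/funext => h /=; rewrite /to_base !mxE !eqxx mulr1.
  by rewrite -addrA -scalerDl opprD addrCA [h + _]addrC subrK.
have lin : is_derive (0 : R) 1 (fun h : R => p 0 i2 + h) 1.
  have -> : (fun h : R => p 0 i2 + h) = cst (p 0 i2) + id by [].
  by apply: is_derive_eq; rewrite add0r.
rewrite -[f p]mulr1; apply: is_derive1_comp.
rewrite addr0; apply: is_derive_eq; first by apply: GD; exact: Vp.
by rewrite to_base2 -addrA -scalerDl subrKA subrr scale0r addr0.
Qed.

(** A displacement v splits as w + v_2 e2, where w leaves x2 fixed. For w, the function x |-> P (x +
    w) - P x vanishes at the base and has the uniformly small derivative f (x + w) - f x. Along e2
    the increment is v_2 times a value of [f], which is bounded near [p]. *)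
Lemma based_antiderivative_continuous f P :
  (forall p, V p -> {for p, continuous f}) -> based_antiderivative f P ->
  forall p, V p -> {for p, continuous P}.
Proof.
move=> cf [DP P0] p Vp.
(* [N] bounds the effect of removing all or part of the x2-component of v, so w and the points
   between p + w and p + v stay in the balls obtained below. *)
pose N := 1 + `|e i2|.
have N0 : 0 < N by rewrite ltr_pwDl.
have vb v (x : R) : `|x| <= `|v| -> `|v - x *: e i2| <= `|v| * N.
  move=> xv; rewrite (le_trans (ler_normB _ _))// normrZ mulrDr mulr1 lerD2l.
  by rewrite ler_wpM2r.
suff : P @ nbhs p --> P p by [].
apply/(cvgrPdist_lt (FF := nbhs_filter p)) => eps e0.
pose eta := eps / 2 / (`|p 0 i2 - c| + 1).
have eta0 : 0 < eta by rewrite !divr_gt0// ltr_wpDl.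
have Vb := to_base_in Vp.
have /nbhs_ballP[d1 /= d10 H1] := uniform_on_line eta0 cf Vp Vb.
have V0 : V (p + 0 *: e i2) by rewrite scale0r addr0.
(* With s = 0 the segment degenerates to [p], and the tolerance 1 gives the bound |f p| + 1 for |f|
   near [p]. *)
have /nbhs_ballP[d2 /= d20 H2] := uniform_on_line (ltr01 : 0 < 1 :> R) cf Vp V0.
near=> q; pose v := q - p; have -> : q = p + v by rewrite /v addrC subrK.
have hv : `|v| * N < Num.min d1 d2.
  rewrite -ltr_pdivlMr// /v; near: q; apply: cvgr_distC_lt => //.
  by rewrite divr_gt0// lt_min d10.
have hv3 : `|v| < eps / 2 / (`|f p| + 1).
  rewrite /v; near: q; apply: cvgr_distC_lt => //.
  by rewrite !divr_gt0// ltr_wpDl.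
pose w := v - v 0 i2 *: e i2.
have cvi := coord_le_norm v i2.
have B2 (t : R) : 0 <= t <= 1 -> V (p + w + (t * v 0 i2) *: e i2) /\
    `|f (p + w + (t * v 0 i2) *: e i2) - f p| < 1.
  move=> /andP[t0 t1].
  have := H2 (v - ((1 - t) * v 0 i2) *: e i2) _ 0 _.
  rewrite mul0r scale0r addr0 => H.
  have -> : p + w + (t * v 0 i2) *: e i2 = p + (v - ((1 - t) * v 0 i2) *: e i2).
    rewrite mulrBl mul1r scalerBl opprB [_ - v 0 i2 *: e i2]addrC.
    by rewrite /w -!addrA.
  apply: H; last by rewrite lexx ler01.
  rewrite -ball_normE /= sub0r normrN.
  apply: (le_lt_trans (vb _ _ _)); last by move: hv; rewrite lt_min => /andP[].
  rewrite normrM (le_trans _ cvi)// ler_piMl// ger0_norm ?subr_ge0//; lra.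
have B1 : forall t : R, 0 <= t <= 1 -> 
    V (p + (t * (c - p 0 i2)) *: e i2 + w) /\
    `|f (p + (t * (c - p 0 i2)) *: e i2 + w) - f (p + (t * (c - p 0 i2)) *: e i2)| < eta.
  apply: H1; rewrite -ball_normE /= sub0r normrN.
  by apply: (le_lt_trans (vb _ _ cvi)); move: hv; rewrite lt_min => /andP[].
have [t t01 E2] : exists2 t : R, 0 <= t <= 1 &
    P (p + w + v 0 i2 *: e i2) - P (p + w) = v 0 i2 * f (p + w + (t * v 0 i2) *: e i2).
  by apply: mean_value => t t01; apply: DP; have [] := B2 t t01.
have [s s01 E1] : exists2 t : R, 0 <= t <= 1 & P (p + w) - P p = (p 0 i2 - c) *
    (f (p + (t * (c - p 0 i2)) *: e i2 + w) - f (p + (t * (c - p 0 i2)) *: e i2)).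
  apply: (@mean_value_from_base (fun x => P (x + w) - P x)
    (fun x => f (x + w) - f x)) => [t' t01'|].
    have [Vw _] := B1 t' t01'.
    apply: is_deriveB; first exact/is_derive_shift_arg/DP.
    exact/DP/open_box_line.
  have [] := B1 1; first by rewrite ler01 lexx.
  rewrite mul1r -/(to_base p) => Vw _.
  rewrite (P0 _ Vb (to_base2 p)) (P0 _ Vw) ?subrr//.
  by rewrite mxE to_base2 !mxE !eqxx mulr1 subrr addr0.
have [_ b2] := B2 t t01; have [_ b1] := B1 s s01.
have -> : p + v = p + w + v 0 i2 *: e i2 by rewrite /w -!addrA addNr addr0.
rewrite distrC.
set X := P (p + w + _) in E2 *; set Y := P (p + w) in E2 E1.
have -> : X - P p = (X - Y) + (Y - P p) by rewrite addrA subrK.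
apply: (le_lt_trans (ler_normD _ _)); rewrite E1 E2 !normrM.
rewrite (splitr eps); apply: ltr_leD.
  have fb : `|f (p + w + (t * v 0 i2) *: e i2)| <= `|f p| + 1.
    rewrite -lerBlDl; apply: le_trans (ltW b2); exact: lerB_dist.
  apply: le_lt_trans (ler_pM _ _ cvi fb) _ => //.
  by rewrite -ltr_pdivlMr// ltr_wpDl.
apply: le_trans (ler_wpM2l _ (ltW b1)) _ => //.
rewrite /eta mulrA ler_pdivrMr ?ltr_wpDl// mulrC ler_wpM2l ?lerDl//.
by rewrite ltW// divr_gt0.
Unshelve. all: by end_near. Qed.

(* Differentiation under the integral sign without integrals: along the x2-line
   through [p] the function [x |-> P (x + h e_j) - P x - h Q x] vanishes at the
   base and has derivative [f (x + h e_j) - f x - h g x], which is [o(h)]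
   uniformly; apply the mean value theorem. *)
Lemma based_antiderivative_partial f g P Q j : j != i2 ->
  (forall p, V p -> is_derive p (e j) f (g p)) ->
  (forall p, V p -> {for p, continuous g}) ->
  based_antiderivative f P -> based_antiderivative g Q ->
  forall p, V p -> is_derive p (e j) P (Q p).
Proof.
move=> j2 Df cg [DP P0] [DQ Q0] p Vp.
suff H : h^-1 *: (P (h *: e j + p) - P p) @[h --> (0 : R)^'] --> Q p.
  by split; [apply/cvg_ex; exists (Q p)|apply: cvg_lim].
apply/cvgrPdist_lt => eps e0.
pose eta := eps / (`|p 0 i2 - c| + 1).
have eta0 : 0 < eta by rewrite !divr_gt0// ltr_wpDl.
have Vb := to_base_in Vp.
have /nbhs_ballP[d1 /= d10 H1] := uniform_on_line eta0 cg Vp Vb.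
near=> h.
have h0 : h != 0 by near: h; exact: nbhs_dnbhs_neq.
have hd : `|h| * (`|e j| + 1) < d1.
  rewrite -ltr_pdivlMr ?ltr_wpDl//; near: h; apply: dnbhs0_lt.
  by rewrite divr_gt0// ltr_wpDl.
have B1 (r t : R) : 0 <= r <= 1 -> 0 <= t <= 1 ->
    V (p + (t * (c - p 0 i2)) *: e i2 + (r * h) *: e j) /\
    `|g (p + (t * (c - p 0 i2)) *: e i2 + (r * h) *: e j)
      - g (p + (t * (c - p 0 i2)) *: e i2)| < eta.
  move=> /andP[r0 r1]; apply: H1; rewrite -ball_normE /= sub0r normrN.
  apply: le_lt_trans hd; rewrite normrZ ler_pM//; last by rewrite lerDl.
  by rewrite normrM ler_piMl// ger0_norm.
pose d x := f (x + h *: e j) - f x - h * g x.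
have B1' (t : R) : 0 <= t <= 1 -> V (p + (t * (c - p 0 i2)) *: e i2 + h *: e j).
  by move=> t01; have [] := B1 1 t; rewrite ?ler01 ?lexx// mul1r.
have [t t01 E] : exists2 t : R, 0 <= t <= 1 & P (p + h *: e j) - P p - h * Q p =
    (p 0 i2 - c) * d (p + (t * (c - p 0 i2)) *: e i2).
  apply: (@mean_value_from_base (fun x => P (x + h *: e j) - P x - h * Q x) d).
    move=> t t01; have Vt := open_box_line t01 Vp Vb.
    apply: is_deriveB; last by apply: is_deriveZ; exact: DQ.
    apply: is_deriveB; last exact: DP.
    by apply: is_derive_shift_arg; apply: DP; exact: B1'.
  (* As [j] differs from [i2], the shift by h e_j stays in the slice x2 = c, so all three terms
     vanish at the base. *)
  have := B1' 1; rewrite ler01 lexx mul1r => /(_ isT); rewrite -/(to_base p) => Vh.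
  rewrite (P0 _ Vb (to_base2 p)) (Q0 _ Vb (to_base2 p)) (P0 _ Vh) ?mulr0 ?subrr//.
  by rewrite mxE to_base2 mxE coord_vecE eq_sym (negbTE j2) mulr0 addr0.
have Vt := open_box_line t01 Vp Vb.
(* A second mean value theorem, now along e_j, writes [d] as h times a difference of values of [g],
   which [B1] bounds. *)
have [r r01 E'] := @mean_value R _ f g (p + (t * (c - p 0 i2)) *: e i2) (e j) h
  (fun r r01 => Df _ (B1 r t r01 t01).1).
have [_ b1] := B1 r t r01 t01.
have -> : Q p - h^-1 *: (P (h *: e j + p) - P p) =
    - (p 0 i2 - c) * (g (p + (t * (c - p 0 i2)) *: e i2 + (r * h) *: e j)
      - g (p + (t * (c - p 0 i2)) *: e i2)).
  move: E; rewrite /d E' [h *: e j + p]addrC -[h^-1 *: _]/(h^-1 * _) => E.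
  have -> : P (p + h *: e j) - P p = h * Q p + (P (p + h *: e j) - P p - h * Q p).
    by ring.
  by rewrite E; field.
rewrite normrM normrN; apply: (le_lt_trans (ler_wpM2l _ (ltW b1))) => //.
rewrite /eta mulrA ltr_pdivrMr ?ltr_wpDl// mulrC ltr_pM2l// ltrDl//.
Unshelve. all: by end_near. Qed.

(** Along x2 the derivative is [f] itself. In the other directions it is the based antiderivative of
    the corresponding derivative of [f], to which the induction hypothesis applies. *)
Lemma based_antiderivative_Ck k f P : Ck_on k V f -> based_antiderivative f P ->
  Ck_on k V P.
Proof.
elim: k f P => [|k IH] f P Cf AP; have [cf df] := Cf;
  have cP := based_antiderivative_continuous cf AP; split => //.
move=> i; have [->|i2i] := eqVneq i i2.
  have [DP _] := AP; split; first by move=> p /DP[].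
  apply: (Ck_on_eq open_box_open _ (Ck_onS Cf)) => p /DP[_ <-] //.
have [dfi Cfi] := df i.
have [cfi _] : Ck_on 0 V (partial i f) by case: (k) Cfi => [|k'] [? _].
have [Q AQ] := based_antiderivative_exists cfi.
have D p : V p -> is_derive p (e i) P (Q p).
  apply: (based_antiderivative_partial i2i _ cfi AP AQ) => q Vq.
  exact/derivableP/dfi.
split; first by move=> p /D[].
apply: (Ck_on_eq open_box_open _ (IH _ _ Cfi AQ)) => p /D[_ <-] //.
Qed.

End BoxAntiderivative.

(** * Functions of (x2, x3) on a box and the linearised equation *)

Section BoxFunctions.
Set Implicit Arguments.
Unset Strict Implicit.
Variables (R : realType) (a b : 'rV[R]_3).
Local Notation pt := 'rV[R]_3.
Local Notation e := (coord_vec R).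
Local Notation V := (open_box a b).
Implicit Types (f P Q : pt -> R) (p q m : pt) (i j : 'I_3).

Lemma partial_eq0_constant f i p (s : R) :
  (forall q, V q -> derivable f q (e i)) ->
  (forall q, V q -> partial i f q = 0) ->
  V p -> a 0 i < s < b 0 i -> f (p + (s - p 0 i) *: e i) = f p.
Proof.
move=> df f0 Vp hs; apply: constant_along => t t01.
have Vt : V (p + (t * (s - p 0 i)) *: e i).
  by apply: open_box_line => //; exact: open_box_coord.
by rewrite -(f0 _ Vt); exact/derivableP/df.
Qed.

(** Every point slides along x1, inside the box, to the first coordinate of a fixed point [m]. Used
    below to see that antiderivatives do not depend on x1. *)
Lemma open_box_x1_reducible : x1_reducible V.
Proof.
move=> f sf f1.
have [[m Vm]|n] := pselect (V !=set0); last first.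
  by exists (fun _ _ => 0) => p Vp; case: n; exists p.
pose x (s t : R) : pt := \row_j (if j == i1 then m 0 i1 else if j == i2 then s else t).
exists (fun s t => f (x s t)) => p Vp.
rewrite -(@partial_eq0_constant f i1 p (m 0 i1)) //; last first.
  by move=> q Vq; exact: (smooth_on_derivable sf Vq).
congr (f _); apply/rowP => j; rewrite !mxE eqxx /=.
case: j => -[|[|[|//]]] Hj; rewrite -!val_eqE /=.
- by rewrite mulr1 (_ : Ordinal Hj = i1); [rewrite addrC subrK|exact/val_inj].
- by rewrite mulr0 addr0; congr (p 0 _); exact/val_inj.
- by rewrite mulr0 addr0; congr (p 0 _); exact/val_inj.
Qed.

Lemma antiderivative_x2_exists f : smooth_on V f -> fun_of_x23 V f ->
  exists P, antiderivative_x2 V f P.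
Proof.
move=> sf f23.
have [[m Vm]|n] := pselect (V !=set0); last first.
  have V0 p : ~ V p by move=> Vp; apply: n; exists p.
  exists f; split => // p /V0 [].
have cf p : V p -> {for p, continuous f} by exact: smooth_on_continuous sf.
have [P AP] := based_antiderivative_exists (Vm i2) cf.
have sP : smooth_on V P by move=> k; exact: (based_antiderivative_Ck (Vm i2) (sf k) AP).
have [DP P0] := AP.
exists P; split => //; last by move=> p /DP[_ <-].
apply: open_box_x1_reducible => // p Vp.
have D (q : pt) : V q -> is_derive q (e i1) P 0.
  (* The integrand has zero x1-derivative, and 0 is a based antiderivative of 0; hence the
     x1-derivative of [P] is 0. *)
  apply: (@based_antiderivative_partial R a b _ (Vm i2) f (fun=> 0) P (fun=> 0)) => //.
  - move=> x Vx; rewrite -(fun_of_x23_partial1 (@open_box_open R a b) f23 Vx).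
    by apply/derivableP; exact: smooth_on_derivable sf Vx.
  - by move=> x _; exact: cst_continuous.
  - by split => // x _; exact: is_derive_cst.
by have [_ <-] := D p Vp.
Qed.

(* With [w = F / zeta] and [E = exp (- 2 P)], where [P_2 = 1 / (beta F)], the
   equation is [w_2 = r + 2 w / (beta F)], that is [(w E)_2 = r E = Q_2]. *)
Lemma frame_eq_solution (alpha beta zeta F P Q : pt -> R) :
  smooth_on V beta -> smooth_on V zeta -> smooth_on V F ->
  fun_of_x23 V zeta -> fun_of_x23 V F ->
  (forall p, V p -> beta p != 0) -> (forall p, V p -> zeta p != 0) ->
  (forall p, V p -> F p != 0) ->
  antiderivative_x2 V (fun p => (beta p * F p)^-1) P ->
  antiderivative_x2 V (fun p => expR (- 2 * P p) * ratio_3 alpha beta p) Q ->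
  (forall p, V p -> frame_eq alpha beta zeta F p) <->
  exists K : R -> R, smooth_on V (fun p => K (p 0 i3)) /\
    forall p, V p -> Q p - K (p 0 i3) != 0 /\
      zeta p = F p * (expR (- 2 * P p) / (Q p - K (p 0 i3))).
Proof.
move=> sb sz sF z23 F23 b0 z0 F0 [sP P23 DP] [sQ Q23 DQ].
have oV := @open_box_open R a b.
pose N p := - 2 * P p.
have sN : smooth_on V N by apply: smooth_onM => //; exact: smooth_on_cst.
have sE : smooth_on V (fun p => expR (N p)) by exact: smooth_on_expR.
pose w p := F p / zeta p.
have sw : smooth_on V w by exact: smooth_on_div.
pose Y p := w p * expR (N p).
have sY : smooth_on V Y by exact: smooth_onM.
have E2 p : V p -> partial i2 (fun q => expR (N q)) p =
    expR (N p) * (- 2 * (beta p * F p)^-1).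
  move=> Vp; rewrite (partial_expR _ sN Vp); congr (_ * _).
  rewrite /N (partialM _ (smooth_on_cst _ _) sP Vp) DP//.
  by rewrite partial_cst mulr0 addr0.
have w2 p : V p -> partial i2 w p = (partial i2 F p * zeta p - F p * partial i2 zeta p) / zeta p ^+ 2.
  by move=> Vp; rewrite /w (partial_div _ oV sF sz z0 Vp).
have Y2 p : V p -> partial i2 Y p = expR (N p) *
   ((partial i2 F p * zeta p - F p * partial i2 zeta p) / zeta p ^+ 2
    - 2 / (beta p * zeta p)).
  move=> Vp; rewrite /Y (partialM _ sw sE Vp) E2// w2//.
  by have := b0 _ Vp; have := z0 _ Vp; have := F0 _ Vp => ? ? ?; rewrite /w; field; apply/and3P.
have feE p : V p -> frame_eq alpha beta zeta F p <-> partial i2 Y p = partial i2 Q p.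
  move=> Vp; rewrite Y2// DQ// -/(N p) /frame_eq.
  have z0p := z0 _ Vp; have b0p := b0 _ Vp.
  have E0 : expR (N p) != 0 by rewrite expR_eq0.
  (* The equation is - zeta^2 times the linear equation for w = F / zeta, and zeta does not
     vanish. *)
  set A := (X in X = 0); set B := (X in _ <-> X).
  have AE : A = - zeta p ^+ 2 * ((partial i2 F p * zeta p - F p * partial i2 zeta p) / zeta p ^+ 2
    - 2 / (beta p * zeta p) - ratio_3 alpha beta p).
    by rewrite /A; field; apply/andP.
  rewrite AE /B; split => [/eqP|/(mulfI E0) ->]; last by rewrite subrr mulr0.
  by rewrite mulf_eq0 oppr_eq0 expf_eq0 /= (negbTE z0p) /= subr_eq0 => /eqP ->.
split => [fe|[K [sK HK]]].
  pose k p := Q p - Y p.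
  have sk : smooth_on V k by exact: smooth_onB.
  have k2 p : V p -> partial i2 k p = 0.
    move=> Vp; rewrite /k (partialD _ sQ (smooth_onN oV sY) Vp) (partialN _ sY Vp).
    by rewrite ((feE p Vp).1 (fe p Vp)) subrr.
  have k1 p : V p -> partial i1 k p = 0.
    move=> Vp; rewrite /k (partialD _ sQ (smooth_onN oV sY) Vp) (partialN _ sY Vp).
    rewrite (fun_of_x23_partial1 oV Q23 Vp) /Y (partialM _ sw sE Vp).
    rewrite (partial_expR _ sN Vp) /N (partialM _ (smooth_on_cst _ _) sP Vp).
    rewrite (fun_of_x23_partial1 oV P23 Vp) partial_cst.
    rewrite /w (partial_div _ oV sF sz z0 Vp).
    rewrite (fun_of_x23_partial1 oV F23 Vp) (fun_of_x23_partial1 oV z23 Vp).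
    by rewrite !(mulr0, mul0r, addr0, subrr, oppr0).
  have [[m Vm]|n] := pselect (V !=set0); last first.
    have V0 p : ~ V p by move=> Vp; apply: n; exists p.
    exists (fun=> 0); split; first exact: smooth_on_cst.
    by move=> p /V0.
  (* [k] has zero x1- and x2-derivative, so it can be read off on the x3-line through [m]; a point
     of the box reaches that line by one move along x1 and one along x2. *)
  pose K t := k (m + (t - m 0 i3) *: e i3).
  have KE p : V p -> K (p 0 i3) = k p.
    move=> Vp; pose q := p + (m 0 i1 - p 0 i1) *: e i1.
    have Vq : V q by exact: open_box_coord.
    have dk i q' : V q' -> derivable k q' (e i) by move=> h; exact: smooth_on_derivable sk h.
    rewrite -(partial_eq0_constant (dk i1) k1 Vp (Vm i1)) -/q.
    rewrite -(partial_eq0_constant (dk i2) k2 Vq (Vm i2)).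
    congr (k _); apply/rowP => j; rewrite !mxE !eqxx /=.
    case: j => -[|[|[|//]]] Hj; rewrite -!val_eqE /=.
    - by rewrite !(mulr0, mulr1, addr0) (_ : Ordinal Hj = i1); [ring|exact/val_inj].
    - by rewrite !(mulr0, mulr1, addr0) (_ : Ordinal Hj = i2); [ring|exact/val_inj].
    - by rewrite !(mulr0, mulr1, addr0) (_ : Ordinal Hj = i3); [ring|exact/val_inj].
  exists K; split; first by apply: (smooth_on_eq oV _ sk) => p Vp; rewrite KE.
  move=> p Vp; rewrite KE// /k opprB addrC subrK /Y /w.
  have := z0 _ Vp; have := F0 _ Vp => F0p z0p.
  have E0 : expR (N p) != 0 by rewrite expR_eq0.
  split; first by rewrite !mulf_neq0 ?invr_eq0.
  by rewrite -/(N p); field; apply/and3P.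
move=> p Vp; apply/(feE p Vp).
have K2 q : V q -> partial i2 (fun p => K (p 0 i3)) q = 0.
  move=> Vq; rewrite /partial; apply: (@derive_val _ _ _ _ _ _ _ _).
  apply/is_derive_lineP.
  have -> : (fun h : R => K ((q + h *: e i2) 0 i3)) = cst (K (q 0 i3)).
    by apply/funext => h; rewrite !mxE /= mulr0 addr0.
  exact: is_derive_cst.
have YE q : V q -> Q q - K (q 0 i3) = Y q.
  move=> Vq; have [D0 zE] := HK q Vq; rewrite /Y /w zE -/(N q).
  have F0q := F0 _ Vq; have E0 : expR (N q) != 0 by rewrite expR_eq0.
  by field; apply/and3P.
rewrite -(partial_eq_on _ oV YE Vp) (partialD _ sQ (smooth_onN oV sK) Vp).
by rewrite (partialN _ sK Vp) K2// oppr0 addr0.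
Qed.

End BoxFunctions.

(** * Frames and differential forms in coordinates *)

Section FrameComponents.
Set Implicit Arguments.
Unset Strict Implicit.
Variable R : realType.
Local Notation pt := 'rV[R]_3.
Local Notation e := (coord_vec R).

Lemma ord3_ind (P : 'I_3 -> Prop) : P i1 -> P i2 -> P i3 -> forall i, P i.
Proof.
move=> P1 P2 P3 [[|[|[|//]]] Hi].
- by rewrite (_ : Ordinal Hi = i1)//; exact/val_inj.
- by rewrite (_ : Ordinal Hi = i2)//; exact/val_inj.
- by rewrite (_ : Ordinal Hi = i3)//; exact/val_inj.
Qed.

Lemma sum_ord3 (V : nmodType) (G : 'I_3 -> V) :
  \sum_i G i = G i1 + G i2 + G i3.
Proof.
rewrite !big_ord_recl big_ord0 addr0 addrA.
by congr (_ + _ + _); congr (G _); exact/val_inj.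
Qed.

Lemma mulmx_ord3 m n (A : 'M[R]_(m, 3)) (B : 'M[R]_(3, n)) i j :
  (A *m B) i j = A i i1 * B i1 j + A i i2 * B i2 j + A i i3 * B i3 j.
Proof. by rewrite mxE sum_ord3. Qed.

Lemma frame1E (alpha beta : pt -> R) p :
  ((frame1 alpha beta p 0 i1 = alpha p) * (frame1 alpha beta p 0 i2 = beta p)
  * (frame1 alpha beta p 0 i3 = 0))%type.
Proof.
by rewrite /frame1 !mxE /= !(mulr0, mulr1, addr0, add0r).
Qed.

Lemma frame2E (delta epsilon zeta : pt -> R) p :
  ((frame2 delta epsilon zeta p 0 i1 = delta p)
  * (frame2 delta epsilon zeta p 0 i2 = epsilon p)
  * (frame2 delta epsilon zeta p 0 i3 = zeta p))%type.
Proof.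
by rewrite /frame2 !mxE /= !(mulr0, mulr1, addr0, add0r).
Qed.

Lemma frame3E p : ((frame3 p 0 i1 = 1 :> R) * (frame3 p 0 i2 = 0 :> R)
  * (frame3 p 0 i3 = 0 :> R))%type.
Proof. by rewrite /frame3 !mxE. Qed.

Lemma coord_vec_ord3 : ((e i1 0 i1 = 1) * (e i1 0 i2 = 0) * (e i1 0 i3 = 0)
  * (e i2 0 i1 = 0) * (e i2 0 i2 = 1) * (e i2 0 i3 = 0)
  * (e i3 0 i1 = 0) * (e i3 0 i2 = 0) * (e i3 0 i3 = 1))%type.
Proof. by rewrite !mxE. Qed.

Variable U : set pt.
Hypothesis oU : open U.

Lemma smooth_frame1 (alpha beta : pt -> R) : smooth_on U alpha ->
  smooth_on U beta -> smooth_mx_on U (frame1 alpha beta).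
Proof.
move=> sa sb i j; rewrite ord1 {i}; elim/ord3_ind: j.
- by apply: (smooth_on_eq oU _ sa) => p _; rewrite frame1E.
- by apply: (smooth_on_eq oU _ sb) => p _; rewrite frame1E.
- by apply: (smooth_on_eq oU _ (smooth_on_cst U 0)) => p _; rewrite frame1E.
Qed.

Lemma smooth_frame2 (delta epsilon zeta : pt -> R) : smooth_on U delta ->
  smooth_on U epsilon -> smooth_on U zeta ->
  smooth_mx_on U (frame2 delta epsilon zeta).
Proof.
move=> sd se sz i j; rewrite ord1 {i}; elim/ord3_ind: j.
- by apply: (smooth_on_eq oU _ sd) => p _; rewrite frame2E.
- by apply: (smooth_on_eq oU _ se) => p _; rewrite frame2E.
- by apply: (smooth_on_eq oU _ sz) => p _; rewrite frame2E.
Qed.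

Lemma smooth_mx_cst m n (A : 'M[R]_(m, n)) : smooth_mx_on U (fun=> A).
Proof. by move=> i j; exact: smooth_on_cst. Qed.

Lemma partial_form_apply (eta : pt -> 'cV[R]_3) (Y : pt -> 'rV[R]_3) i p :
  smooth_mx_on U eta -> smooth_mx_on U Y -> U p ->
  partial i (form_apply eta Y) p =
  \sum_k (Y p 0 k * partial i (fun q => eta q k 0) p
          + eta p k 0 * partial i (fun q => Y q 0 k) p).
Proof.
move=> se sY Up.
have -> : form_apply eta Y = fun q =>
    Y q 0 i1 * eta q i1 0 + Y q 0 i2 * eta q i2 0 + Y q 0 i3 * eta q i3 0.
  by apply/funext => q; rewrite /form_apply mulmx_ord3.
have sM k : smooth_on U (fun q => Y q 0 k * eta q k 0) by exact: smooth_onM.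
rewrite (partialD _ (smooth_onD oU (sM i1) (sM i2)) (sM i3) Up).
rewrite (partialD _ (sM i1) (sM i2) Up) sum_ord3.
by rewrite !(partialM _ (sY 0 _) (se _ 0) Up).
Qed.

(** The algebra behind the tensoriality of d eta at a point: [dx i k] stands for the i-th partial
    derivative of the k-th component of X, likewise [dy] and [dn], and the derivatives of X and Y
    cancel. *)
Lemma exterior_derivative_tensorial (x y n : 'I_3 -> R) (dx dy dn : 'I_3 -> 'I_3 -> R) :
  \sum_i x i * (\sum_k (y k * dn i k + n k * dy i k))
  - \sum_i y i * (\sum_k (x k * dn i k + n k * dx i k))
  - \sum_k (\sum_i x i * dy i k - \sum_i y i * dx i k) * n k =
  (x i1 * y i2 - x i2 * y i1) * (dn i1 i2 - dn i2 i1)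
  + (x i1 * y i3 - x i3 * y i1) * (dn i1 i3 - dn i3 i1)
  + (x i2 * y i3 - x i3 * y i2) * (dn i2 i3 - dn i3 i2).
Proof.
rewrite !sum_ord3.
move: (x i1) (x i2) (x i3) (y i1) (y i2) (y i3) (n i1) (n i2) (n i3).
move: (dx i1 i1) (dx i1 i2) (dx i1 i3) (dx i2 i1) (dx i2 i2) (dx i2 i3)
  (dx i3 i1) (dx i3 i2) (dx i3 i3).
move: (dy i1 i1) (dy i1 i2) (dy i1 i3) (dy i2 i1) (dy i2 i2) (dy i2 i3)
  (dy i3 i1) (dy i3 i2) (dy i3 i3).
move: (dn i1 i1) (dn i1 i2) (dn i1 i3) (dn i2 i1) (dn i2 i2) (dn i2 i3)
  (dn i3 i1) (dn i3 i2) (dn i3 i3).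
by move=> *; ring.
Qed.

(** A component of d eta in the convention without the factor 1/2. *)
Definition curl (eta : pt -> 'cV[R]_3) i j p : R :=
  partial i (fun q => eta q j 0) p - partial j (fun q => eta q i 0) p.

Lemma d_form_components (eta : pt -> 'cV[R]_3) (X Y : pt -> 'rV[R]_3) p :
  smooth_mx_on U eta -> smooth_mx_on U X -> smooth_mx_on U Y -> U p ->
  d_form eta X Y p = 2^-1 *
   ((X p 0 i1 * Y p 0 i2 - X p 0 i2 * Y p 0 i1) * curl eta i1 i2 p
    + (X p 0 i1 * Y p 0 i3 - X p 0 i3 * Y p 0 i1) * curl eta i1 i3 p
    + (X p 0 i2 * Y p 0 i3 - X p 0 i3 * Y p 0 i2) * curl eta i2 i3 p).
Proof.
move=> se sX sY Up; rewrite /d_form; congr (_ * _).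
rewrite -(exterior_derivative_tensorial (X p 0) (Y p 0) (fun k => eta p k 0)
  (fun i k => partial i (fun q => X q 0 k) p)
  (fun i k => partial i (fun q => Y q 0 k) p)
  (fun i k => partial i (fun q => eta q k 0) p)).
congr (_ - _ - _).
- by apply: eq_bigr => i _; rewrite (partial_form_apply i se sY Up).
- by apply: eq_bigr => i _; rewrite (partial_form_apply i se sX Up).
- by rewrite /form_apply mxE; apply: eq_bigr => k _; rewrite mxE.
Qed.

(** The components of d/dx1 are constant, so only the x1-derivatives of [Y] remain. The second field
    [Z] lets a field known only on [U], such as phi e1, be replaced by an explicit one. *)
Lemma lie_bracket_frame3 (xi Y Z : pt -> 'rV[R]_3) p :
  (forall q, U q -> xi q = frame3 q) -> (forall q, U q -> Y q = Z q) -> U p ->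
  lie_bracket xi Y p = \row_i partial i1 (fun q => Z q 0 i) p.
Proof.
move=> xiE YZ Up; apply/rowP => i; rewrite !mxE.
have -> : vf_apply Y (fun q => xi q 0 i) p = 0.
  rewrite /vf_apply big1// => k _.
  rewrite (@partial_eq_on R U _ (fun=> frame3 (0 : pt) 0 i) k p oU)//.
    by rewrite partial_cst mulr0.
  by move=> q Uq; rewrite xiE.
rewrite subr0 /vf_apply sum_ord3 (xiE _ Up) !frame3E !mul0r !addr0 mul1r.
by apply: (partial_eq_on _ oU _ Up) => q Uq; rewrite YZ.
Qed.

End FrameComponents.

(** * The metric as determined by its orthonormal frame *)

Section AssociatedMetric.
Set Implicit Arguments.
Unset Strict Implicit.
Variable R : realType.
Local Notation pt := 'rV[R]_3.

(* The frame in the order [e3, e1, e2], which makes its matrix triangular. *)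
Definition frame_mx (alpha beta delta epsilon zeta : pt -> R) p : 'M[R]_3 :=
  \matrix_(i, j) nth 0 (nth [::]
    [:: [:: 1; 0; 0]; [:: alpha p; beta p; 0];
        [:: delta p; epsilon p; zeta p]] i) j.

(* The inverse of [frame_mx]; here delta is eliminated through [F]. *)
Definition coframe_mx (alpha beta epsilon zeta F : pt -> R) p : 'M[R]_3 :=
  \matrix_(i, j) nth 0 (nth [::]
    [:: [:: 1; 0; 0]; [:: - (alpha p / beta p); (beta p)^-1; 0];
        [:: - (F p / zeta p); - (epsilon p / (beta p * zeta p)); (zeta p)^-1]]
    i) j.

Section AtPoint.
Variables (g : pt -> 'M[R]_3) (alpha beta delta epsilon zeta F : pt -> R) (p : pt).
Hypothesis (b0 : beta p != 0) (z0 : zeta p != 0).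
Hypothesis deltaE : delta p = alpha p * epsilon p / beta p + F p.
Hypothesis gT : (g p)^T = g p.

Let E := frame_mx alpha beta delta epsilon zeta p.
Let C := coframe_mx alpha beta epsilon zeta F p.

Lemma coframe_mxK : C *m E = 1%:M.
Proof.
apply/matrixP => i j; rewrite mulmx_ord3 !mxE.
by elim/ord3_ind: i; elim/ord3_ind: j; rewrite /= ?deltaE; field;
  rewrite ?b0 ?z0.
Qed.

(** The rows of [C] are the frame coordinates of the coordinate vectors, so the Gram matrix of the
    latter is the product of [C] with its transpose. *)
Lemma assoc_metricE : assoc_metric alpha beta epsilon zeta F p = C *m C^T.
Proof.
apply/matrixP => i j; rewrite mulmx_ord3 !mxE.
by elim/ord3_ind: i; elim/ord3_ind: j; rewrite /=; field; rewrite ?b0 ?z0.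
Qed.

Hypothesis on :
  [/\ inner g (frame1 alpha beta) (frame1 alpha beta) p = 1,
      inner g (frame2 delta epsilon zeta) (frame2 delta epsilon zeta) p = 1 &
      inner g (@frame3 R) (@frame3 R) p = 1] /\
  [/\ inner g (frame1 alpha beta) (frame2 delta epsilon zeta) p = 0,
      inner g (frame1 alpha beta) (@frame3 R) p = 0 &
      inner g (frame2 delta epsilon zeta) (@frame3 R) p = 0].

Lemma inner_sym X Y : inner g X Y p = inner g Y X p.
Proof.
rewrite /inner -[in LHS](trmxK (X p *m g p *m (Y p)^T)) [LHS]mxE.
by rewrite !trmx_mul trmxK gT mulmxA.
Qed.

Lemma frame_mx_orthonormal : E *m g p *m E^T = 1%:M.
Proof.
have [[n11 n22 n33] [n12 n13 n23]] := on.
have r1 : row i1 E = frame3 p.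
  by apply/rowP; elim/ord3_ind; rewrite !mxE.
have r2 : row i2 E = frame1 alpha beta p.
  by apply/rowP; elim/ord3_ind; rewrite frame1E !mxE.
have r3 : row i3 E = frame2 delta epsilon zeta p.
  by apply/rowP; elim/ord3_ind; rewrite frame2E !mxE.
have en i j : (E *m g p *m E^T) i j = (row i E *m g p *m (row j E)^T) 0 0.
  by rewrite tr_row -row_mul colE mulmxA -row_mul -colE !mxE.
apply/matrixP => i j; rewrite en [RHS]mxE.
elim/ord3_ind: i; elim/ord3_ind: j; rewrite ?r1 ?r2 ?r3.
- exact: n33.
- exact: (etrans (inner_sym _ _) n13).
- exact: (etrans (inner_sym _ _) n23).
- exact: n13.
- exact: n11.
- exact: n12.
- exact: n23.
- exact: (etrans (inner_sym _ _) n12).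
- exact: n22.
Qed.

Lemma metric_eq_assoc_metric : g p = assoc_metric alpha beta epsilon zeta F p.
Proof.
rewrite assoc_metricE.
have -> : g p = C *m (E *m g p *m E^T) *m C^T.
  rewrite -!mulmxA -trmx_mul coframe_mxK trmx1 mulmx1 !mulmxA.
  by rewrite coframe_mxK mul1mx.
by rewrite frame_mx_orthonormal mulmx1.
Qed.

Lemma det_metric : \det (g p) = 1 / (beta p ^+ 2 * zeta p ^+ 2).
Proof.
rewrite metric_eq_assoc_metric assoc_metricE det_mulmx det_tr.
have -> : \det C = (beta p)^-1 * (zeta p)^-1.
  rewrite det_trig.
    rewrite /C !big_ord_recl big_ord0 !mxE /=.
    by rewrite !mulr1 mul1r.
  apply/is_trig_mxP => i j; rewrite mxE.
  by elim/ord3_ind: i; elim/ord3_ind: j.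
by field; rewrite b0 z0.
Qed.

End AtPoint.
End AssociatedMetric.

(** * Contact metric structures with the given eigenbasis *)

Section Necessity.
Set Implicit Arguments.
Unset Strict Implicit.
Variables (R : realType) (U : set 'rV[R]_3) (g : 'rV[R]_3 -> 'M[R]_3).
Variables (alpha beta delta epsilon zeta : 'rV[R]_3 -> R).
Hypotheses (oU : open U) (U_small : x1_reducible U).
Hypotheses (sa : smooth_on U alpha) (sb : smooth_on U beta)
  (sd : smooth_on U delta) (se : smooth_on U epsilon) (sz : smooth_on U zeta).
Hypothesis bz0 : forall p, U p -> beta p * zeta p != 0.
Variables (eta : 'rV[R]_3 -> 'cV[R]_3) (xi : 'rV[R]_3 -> 'rV[R]_3)
  (phi : 'rV[R]_3 -> 'M[R]_3).
Local Notation pt := 'rV[R]_3.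
Local Notation e1 := (frame1 alpha beta).
Local Notation e2 := (frame2 delta epsilon zeta).
Local Notation e3 := (@frame3 R).
Hypothesis cms : contact_metric_structure U g eta xi phi.
Hypothesis eig : phi_eigenbasis U g xi phi e1 e2 e3.
Local Notation n2 := (fun p => eta p i2 0).
Local Notation n3 := (fun p => eta p i3 0).

Let b0 p : U p -> beta p != 0.
Proof. by move=> /bz0; rewrite mulf_eq0 => /norP[]. Qed.

Let z0 p : U p -> zeta p != 0.
Proof. by move=> /bz0; rewrite mulf_eq0 => /norP[]. Qed.

Let xiE p : U p -> xi p = e3 p.
Proof. by case: eig => _ h _ _ /h. Qed.

Let phi1 p : U p -> tensor_apply phi e1 p = e2 p.
Proof. by case: eig => _ _ h _ /h. Qed.

Let sn k : smooth_on U (fun p => eta p k 0).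
Proof. exact: (cms_eta_smooth cms). Qed.

Let eta1 p : U p -> eta p i1 0 = 1.
Proof.
move=> Up; rewrite -(cms_eta_xi cms Up) /form_apply mulmx_ord3 xiE//.
by rewrite !frame3E !mul0r mul1r !addr0.
Qed.

Let eta_e1 p : U p -> alpha p + beta p * n2 p = 0.
Proof.
move=> Up; have [/(_ p Up)[_ [_ h _]] _ _ _] := eig.
have := cms_eta_metric cms (smooth_frame1 oU sa sb) Up.
rewrite /inner xiE// -/(inner g e1 e3 p) h /form_apply mulmx_ord3.
by rewrite !frame1E eta1// mulr1 mul0r addr0.
Qed.

Let eta_e2 p : U p -> delta p + epsilon p * n2 p + zeta p * n3 p = 0.
Proof.
move=> Up; have [/(_ p Up)[_ [_ _ h]] _ _ _] := eig.
have := cms_eta_metric cms (smooth_frame2 oU sd se sz) Up.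
rewrite /inner xiE// -/(inner g e2 e3 p) h /form_apply mulmx_ord3.
by rewrite !frame2E eta1// mulr1.
Qed.

Let partial_eta1 i p : U p -> partial i (fun q => eta q i1 0) p = 0.
Proof. by move=> Up; rewrite (partial_eq_on i oU eta1 Up) partial_cst. Qed.

(** Contract d eta with xi = d/dx1 and a constant coordinate field: as eta_1 = 1, only half the
    x1-derivative of eta_j is left. *)
Let d_eta_xi j p : U p -> partial i1 (fun q => eta q j 0) p = 0.
Proof.
move=> Up; have := cms_deta_xi cms (smooth_mx_cst U (coord_vec R j)) Up.
rewrite (d_form_components oU (cms_eta_smooth cms) (cms_xi_smooth cms)
  (smooth_mx_cst U _) Up) xiE// !frame3E.
elim/ord3_ind: j; first by rewrite partial_eta1.
- rewrite !coord_vec_ord3 !(mulr0, mul0r, mul1r, oppr0, addr0, add0r) /curl.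
  rewrite partial_eta1// subr0 => /eqP.
  by rewrite mulf_eq0 invr_eq0 pnatr_eq0 /= => /eqP.
- rewrite !coord_vec_ord3 !(mulr0, mul0r, mul1r, oppr0, addr0, add0r) /curl.
  rewrite partial_eta1// subr0 => /eqP.
  by rewrite mulf_eq0 invr_eq0 pnatr_eq0 /= => /eqP.
Qed.

Let n2_x23 : fun_of_x23 U n2.
Proof. by apply: U_small => // p; exact: d_eta_xi. Qed.

Let n3_x23 : fun_of_x23 U n3.
Proof. by apply: U_small => // p; exact: d_eta_xi. Qed.

(** Here phi e2 = phi^2 e1 = - e1 + eta(e1) xi = - e1, so the metric side is -1; clearing the factor
    1/2 gives -2. *)
Let d_eta_e1_e2 p : U p ->
  beta p * zeta p * (partial i2 n3 p - partial i3 n2 p) = - 2.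
Proof.
move=> Up.
have := cms_deta_metric cms (smooth_frame1 oU sa sb) (smooth_frame2 oU sd se sz) Up.
have -> : inner g e1 (tensor_apply phi e2) p = -1.
  have [/(_ p Up)[[n11 _ _] [_ n13 _]] _ _ _] := eig.
  have -> : inner g e1 (tensor_apply phi e2) p = inner g e1 (fun q => - e1 q) p.
    rewrite /inner; congr ((_ *m _^T) 0 0).
    rewrite /tensor_apply -(phi1 Up) /tensor_apply -mulmxA (cms_phi_square cms Up).
    rewrite mulmxDr mulmxN mulmx1 mulmxA.
    suff -> : e1 p *m eta p = 0 by rewrite mul0mx addr0.
    apply/matrixP => i j; rewrite !ord1 mulmx_ord3 !frame1E eta1// mxE.
    by rewrite mulr1 mul0r addr0; exact: eta_e1.
  by rewrite -n11 /inner linearN /= mulmxN mxE.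
rewrite (d_form_components oU (cms_eta_smooth cms) (smooth_frame1 oU sa sb)
  (smooth_frame2 oU sd se sz) Up) !frame1E !frame2E.
rewrite {1 2}/curl !partial_eta1// !d_eta_xi// subr0 !mulr0 !add0r mul0r subr0.
by rewrite -/(curl eta i2 i3 p); move: (curl _ _ _ _) => w; lra.
Qed.

Let omega p := partial i2 n3 p - partial i3 n2 p.

(** Differentiate the preceding identity along x1. [omega] is nonzero, and it is independent of x1
    because x2- and x3-derivatives of functions of (x2, x3) are again such functions; no mixed
    partials are interchanged. *)
Let beta_zeta_1 p : U p ->
  beta p * partial i1 zeta p + zeta p * partial i1 beta p = 0.
Proof.
move=> Up.
have so : smooth_on U omega by apply: smooth_onB => //; exact: smooth_on_partial.
have o1 : partial i1 omega p = 0.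
  rewrite /omega (partialD _ (smooth_on_partial i2 (sn i3))
    (smooth_onN oU (smooth_on_partial i3 (sn i2))) Up).
  rewrite (partialN _ (smooth_on_partial i3 (sn i2)) Up).
  rewrite !(fun_of_x23_partial1 oU _ Up) ?subrr//; exact: fun_of_x23_partial.
have := partial_eq_on i1 oU d_eta_e1_e2 Up.
rewrite partial_cst (partialM _ (smooth_onM oU sb sz) so Up) o1 mulr0 add0r.
rewrite (partialM _ sb sz Up) => /eqP; rewrite mulf_eq0 => /orP[/eqP o0|/eqP//].
have := d_eta_e1_e2 Up; rewrite -/(omega p) o0 mulr0 => /eqP.
by rewrite eq_sym oppr_eq0 pnatr_eq0.
Qed.

Let alphaE p : U p -> alpha p = - (beta p * n2 p).
Proof. by move=> /eta_e1 h; apply/eqP; rewrite -addr_eq0 h. Qed.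

Let alpha_1 p : U p -> partial i1 alpha p = - (n2 p * partial i1 beta p).
Proof.
move=> Up; rewrite (partial_eq_on i1 oU alphaE Up).
rewrite (partialN _ (smooth_onM oU sb (sn i2)) Up) (partialM _ sb (sn i2) Up).
by rewrite d_eta_xi// mulr0 add0r.
Qed.

(* The [x3]-component of [h e1 = lambda e1]. *)
Let zeta_1 p : U p -> beta p * partial i1 zeta p = zeta p * partial i1 beta p.
Proof.
move=> Up; have [_ _ _ [lam /(_ p Up)[h1 _]]] := eig.
have := congr1 (fun v : pt => v 0 i3) h1.
rewrite /h_tensor /lie_derivative (lie_bracket_frame3 oU xiE phi1 Up).
rewrite /tensor_apply (lie_bracket_frame3 oU xiE (fun q _ => erefl (e1 q)) Up).
(* Since alpha = - beta n2, the field e1 is beta times a field independent of x1; hence [xi, e1] =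
   (beta_1 / beta) e1, which phi sends to a multiple of e2. *)
have -> : \row_i partial i1 (fun q => e1 q 0 i) p =
    (partial i1 beta p / beta p) *: e1 p.
  apply/rowP; elim/ord3_ind; rewrite mxE [RHS]mxE frame1E.
  - rewrite (_ : (fun q => e1 q 0 i1) = alpha); last first.
      by apply/funext => q; rewrite frame1E.
    by rewrite alpha_1// alphaE//; have := b0 Up => ?; field.
  - rewrite (_ : (fun q => e1 q 0 i2) = beta); last first.
      by apply/funext => q; rewrite frame1E.
    by have := b0 Up => ?; field.
  - rewrite (_ : (fun q => e1 q 0 i3) = fun=> 0); last first.
      by apply/funext => q; rewrite frame1E.
    by rewrite partial_cst mulr0.
rewrite -scalemxAl -/(tensor_apply phi e1 p) phi1// !mxE.
rewrite (_ : (fun q => e2 q 0 i3) = zeta); last first.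
  by apply/funext => q; rewrite frame2E.
rewrite /= !(mulr0, mulr1, addr0, add0r) => /eqP.
rewrite mulf_eq0 invr_eq0 pnatr_eq0 /= subr_eq0 => /eqP ->.
by have := b0 Up => ?; field.
Qed.

Let beta_1_eq0 p : U p -> partial i1 beta p = 0.
Proof.
move=> Up; have := beta_zeta_1 Up; rewrite zeta_1// -mulr2n => /eqP.
by rewrite mulrn_eq0 /= mulf_eq0 (negbTE (z0 Up)) => /eqP.
Qed.

Lemma eigenbasis_necessary :
  [/\ fun_of_x23 U alpha, fun_of_x23 U beta & fun_of_x23 U zeta] /\
  exists F : pt -> R,
    [/\ smooth_on U F, fun_of_x23 U F,
        (forall p, U p -> delta p = alpha p * epsilon p / beta p + F p) &
        (forall p, U p -> frame_eq alpha beta zeta F p)].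
Proof.
have z1 p : U p -> partial i1 zeta p = 0.
  move=> Up; have := zeta_1 Up; rewrite beta_1_eq0// mulr0 => /eqP.
  by rewrite mulf_eq0 (negbTE (b0 Up)) => /eqP.
split.
  split; [apply: (U_small sa)|apply: (U_small sb)|apply: (U_small sz)] => p Up.
  - by rewrite alpha_1// beta_1_eq0// mulr0 oppr0.
  - exact: beta_1_eq0.
  - exact: z1.
pose F p := delta p - alpha p * epsilon p / beta p.
have FE p : U p -> F p = - (zeta p * n3 p).
  move=> Up; have := eta_e2 Up; rewrite /F alphaE// => h; have := b0 Up => ?.
  have -> : delta p = - (epsilon p * n2 p + zeta p * n3 p).
    by apply/eqP; rewrite -addr_eq0 addrA h.
  by field.
have sF : smooth_on U F.
  by apply: smooth_onB => //; apply: smooth_on_div => //; exact: smooth_onM.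
exists F; split => //.
- apply: U_small => // p Up; rewrite (partial_eq_on i1 oU FE Up).
  rewrite (partialN _ (smooth_onM oU sz (sn i3)) Up) (partialM _ sz (sn i3) Up).
  by rewrite d_eta_xi// z1// !mulr0 addr0 oppr0.
- by move=> p Up; rewrite /F addrC subrK.
move=> p Up; have b0p := b0 Up; have z0p := z0 Up.
have n2E q : U q -> alpha q / beta q = - n2 q.
  by move=> Uq; rewrite alphaE//; have := b0 Uq => ?; field.
rewrite /frame_eq /ratio_3 (partial_eq_on i3 oU n2E Up) (partialN _ (sn i2) Up).
rewrite (partial_eq_on i2 oU FE Up) (partialN _ (smooth_onM oU sz (sn i3)) Up).
rewrite (partialM _ sz (sn i3) Up) FE//.
have := d_eta_e1_e2 Up.
move: (partial i2 n3 p) (partial i3 n2 p) (partial i2 zeta p) => x y z h.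
(* Trading the constant 2 for - beta zeta omega makes the goal an identity of rational functions. *)
have -> : 2 = - (beta p * zeta p * (x - y)) by rewrite h opprK.
by field.
Qed.

End Necessity.

(** * Construction of the contact metric structure *)

Section Sufficiency.
Set Implicit Arguments.
Unset Strict Implicit.
Variables (R : realType) (U : set 'rV[R]_3) (g : 'rV[R]_3 -> 'M[R]_3).
Variables (alpha beta delta epsilon zeta F : 'rV[R]_3 -> R).
Local Notation pt := 'rV[R]_3.
Local Notation e1 := (frame1 alpha beta).
Local Notation e2 := (frame2 delta epsilon zeta).
Local Notation e3 := (@frame3 R).
Hypotheses (oU : open U) (g_riem : riemannian_on U g).
Hypotheses (sa : smooth_on U alpha) (sb : smooth_on U beta)
  (sd : smooth_on U delta) (se : smooth_on U epsilon) (sz : smooth_on U zeta)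
  (sF : smooth_on U F).
Hypothesis bz0 : forall p, U p -> beta p * zeta p != 0.
Hypothesis on : orthonormal_on U g e1 e2 e3.
Hypotheses (a23 : fun_of_x23 U alpha) (b23 : fun_of_x23 U beta)
  (z23 : fun_of_x23 U zeta) (F23 : fun_of_x23 U F).
Hypothesis deltaE : forall p, U p -> delta p = alpha p * epsilon p / beta p + F p.
Hypothesis fe : forall p, U p -> frame_eq alpha beta zeta F p.

Let b0 p : U p -> beta p != 0.
Proof. by move=> /bz0; rewrite mulf_eq0 => /norP[]. Qed.

Let z0 p : U p -> zeta p != 0.
Proof. by move=> /bz0; rewrite mulf_eq0 => /norP[]. Qed.

(* [contact_form] is determined by [eta e1 = eta e2 = 0], [eta e3 = 1], and
   [contact_tensor] is the tensor with [e1 |-> e2], [e2 |-> - e1], [e3 |-> 0],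
   whose rows are the images of the coordinate vectors. *)
Definition contact_form p : 'cV[R]_3 :=
  \col_i nth 0 [:: 1; - (alpha p / beta p); - (F p / zeta p)] i.

Definition contact_tensor p : 'M[R]_3 :=
  \matrix_(i, j) nth 0 (nth [::]
    [:: [:: 0; 0; 0];
        [:: delta p / beta p; epsilon p / beta p; zeta p / beta p];
        [:: - (alpha p / zeta p) - epsilon p * delta p / (beta p * zeta p);
            - (beta p / zeta p) - epsilon p * epsilon p / (beta p * zeta p);
            - (epsilon p / beta p)]]
    i) j.

Local Notation eta := contact_form.
Local Notation phi := contact_tensor.

(** With [g] explicit, its compatibility with [eta] and [phi] becomes a computation with rational
    functions. *)
Let gE p : U p -> g p = assoc_metric alpha beta epsilon zeta F p.
Proof.
move=> Up; have [_ /(_ p Up)[gT _]] := g_riem.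
exact: metric_eq_assoc_metric (b0 Up) (z0 Up) (deltaE Up) gT (on Up).
Qed.

Let smooth_eta : smooth_mx_on U eta.
Proof.
move=> i j; rewrite ord1 {j}.
have E : (fun p => eta p i 0) =
    (fun p => nth 0 [:: 1; - (alpha p / beta p); - (F p / zeta p)] i).
  by apply/funext => p; rewrite mxE.
rewrite E; elim/ord3_ind: i {E} => /=; first exact: smooth_on_cst.
- by apply: smooth_onN => //; exact: smooth_on_div.
- by apply: smooth_onN => //; exact: smooth_on_div.
Qed.

Let smooth_phi : smooth_mx_on U phi.
Proof.
move=> i j.
have s1 : smooth_on U (fun p => epsilon p * delta p / (beta p * zeta p)).
  by apply: smooth_on_div => //; exact: smooth_onM.
have s2 : smooth_on U (fun p => epsilon p * epsilon p / (beta p * zeta p)).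
  by apply: smooth_on_div => //; exact: smooth_onM.
have div f h : (forall p, U p -> h p != 0) -> smooth_on U f -> smooth_on U h ->
  smooth_on U (fun p => f p / h p) by exact: smooth_on_div.
apply: (smooth_on_eq oU (fun p _ => esym (mxE _ _ i j))).
elim/ord3_ind: i; elim/ord3_ind: j => /=; try exact: smooth_on_cst.
- exact: div.
- exact: div.
- exact: div.
- by apply: smooth_onB => //; apply: smooth_onN => //; exact: div.
- by apply: smooth_onB => //; apply: smooth_onN => //; exact: div.
- by apply: smooth_onN => //; exact: div.
Qed.

Let phi_e1 p : U p -> tensor_apply phi e1 p = e2 p.
Proof.
move=> Up; have b0p := b0 Up; have z0p := z0 Up.
apply/rowP; elim/ord3_ind; rewrite mulmx_ord3 !frame1E frame2E !mxE /=;
  by field; rewrite ?b0p ?z0p.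
Qed.

Let phi_e2 p : U p -> tensor_apply phi e2 p = - e1 p.
Proof.
move=> Up; have b0p := b0 Up; have z0p := z0 Up.
apply/rowP; elim/ord3_ind; rewrite mulmx_ord3 !frame2E [RHS]mxE frame1E !mxE /=;
  by field; rewrite ?b0p ?z0p.
Qed.

Let eta_x23 k : fun_of_x23 U (fun p => eta p k 0).
Proof.
have [fa ha] := a23; have [fb hb] := b23; have [fz hz] := z23; have [fF hF] := F23.
exists (fun s t => nth 0 [:: 1; - (fa s t / fb s t); - (fF s t / fz s t)] k).
by move=> p Up; rewrite mxE ha// hb// hz// hF.
Qed.

Let curl12 p : U p -> curl eta i1 i2 p = 0.
Proof.
move=> Up; rewrite /curl (fun_of_x23_partial1 oU (eta_x23 i2) Up).
have -> : (fun q => eta q i1 0) = fun=> 1 by apply/funext => q; rewrite mxE.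
by rewrite partial_cst subrr.
Qed.

Let curl13 p : U p -> curl eta i1 i3 p = 0.
Proof.
move=> Up; rewrite /curl (fun_of_x23_partial1 oU (eta_x23 i3) Up).
have -> : (fun q => eta q i1 0) = fun=> 1 by apply/funext => q; rewrite mxE.
by rewrite partial_cst subrr.
Qed.

(** The left side is (alpha / beta)_3 - (F / zeta)_2, so this is [frame_eq] divided by zeta^2. *)
Let curl23 p : U p -> curl eta i2 i3 p = - (2 / (beta p * zeta p)).
Proof.
move=> Up; rewrite /curl.
have -> : (fun q => eta q i3 0) = (fun q => - (F q / zeta q)).
  by apply/funext => q; rewrite mxE.
have -> : (fun q => eta q i2 0) = (fun q => - (alpha q / beta q)).
  by apply/funext => q; rewrite mxE.
rewrite (partialN _ (smooth_on_div oU z0 sF sz) Up).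
rewrite (partialN _ (smooth_on_div oU b0 sa sb) Up).
rewrite (partial_div _ oU sF sz z0 Up) -/(ratio_3 alpha beta p).
have := fe Up; rewrite /frame_eq.
have b0p := b0 Up; have z0p := z0 Up.
move: (partial i2 F p) (partial i2 zeta p) (ratio_3 alpha beta p) => x y r h.
have {}h : r * zeta p ^+ 2 = (x - 2 / beta p) * zeta p - F p * y.
  by apply/eqP; rewrite -subr_eq0 -h; apply/eqP; ring.
have -> : r = ((x - 2 / beta p) * zeta p - F p * y) / zeta p ^+ 2.
  by rewrite -h; field.
by field; rewrite b0p z0p.
Qed.

Let d_etaE X Y p : smooth_mx_on U X -> smooth_mx_on U Y -> U p ->
  d_form eta X Y p =
  - (X p 0 i2 * Y p 0 i3 - X p 0 i3 * Y p 0 i2) / (beta p * zeta p).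
Proof.
move=> sX sY Up; rewrite (d_form_components oU smooth_eta sX sY Up).
rewrite curl12// curl13// curl23// !mulr0 !add0r.
by have := b0 Up; have := z0 Up => z0p b0p; field; rewrite b0p z0p.
Qed.

Let smooth_e3 : smooth_mx_on U e3.
Proof. by move=> i j; exact: smooth_on_cst. Qed.

Lemma contact_structure_exists : contact_metric_structure U g eta e3 phi.
Proof.
split=> //.
(* On the coordinate fields only eta(d/dx1) d eta(d/dx2, d/dx3) survives in the wedge product. *)
- move=> p Up; exists (fun=> coord_vec R i1), (fun=> coord_vec R i2),
    (fun=> coord_vec R i3).
  split; try exact: smooth_mx_cst.
  rewrite /wedge_d_form !d_etaE//; try exact: smooth_mx_cst.
  rewrite !coord_vec_ord3 /form_apply mulmx_ord3 !coord_vec_ord3 mxE /=.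
  have bz := bz0 Up.
  rewrite !(mulr0, mul0r, mulr1, addr0, subr0, mul1r, oppr0).
  by rewrite mulf_neq0 ?invr_eq0 ?pnatr_eq0// mulNr mul1r oppr_eq0 invr_eq0.
- move=> p Up; rewrite /form_apply mulmx_ord3 !frame3E mxE /=.
  by rewrite !mul0r mul1r !addr0.
- move=> X sX p Up; rewrite d_etaE// !frame3E.
  by rewrite !mul0r subrr oppr0 mul0r.
- move=> p Up; have b0p := b0 Up; have z0p := z0 Up.
  apply/matrixP => i j; rewrite mulmx_ord3 !mxE big_ord1 !mxE deltaE//.
  by elim/ord3_ind: i; elim/ord3_ind: j; rewrite /=; field; rewrite ?b0p ?z0p.
- move=> X sX p Up; rewrite /form_apply /inner -mulmxA; congr ((_ *m _) 0 0).
  rewrite gE//; apply/colP => i; rewrite mulmx_ord3 ![_^T _ _]mxE !frame3E !mxE.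
  by elim/ord3_ind: i; rewrite /= !mulr0 !addr0 mulr1.
- move=> X Y sX sY p Up; rewrite d_etaE// /inner /tensor_apply.
  rewrite trmx_mul mulmxA -(mulmxA (X p)) gE//.
  have b0p := b0 Up; have z0p := z0 Up.
  (* The right-hand matrix is that of the bilinear form d eta, read off from [d_etaE]. *)
  have -> : assoc_metric alpha beta epsilon zeta F p *m (phi p)^T =
      \matrix_(i, j) nth 0 (nth [::] [:: [:: 0; 0; 0];
        [:: 0; 0; - (beta p * zeta p)^-1]; [:: 0; (beta p * zeta p)^-1; 0]] i) j.
    apply/matrixP => i j; rewrite mulmx_ord3 !mxE deltaE//.
    by elim/ord3_ind: i; elim/ord3_ind: j; rewrite /=; field; rewrite ?b0p ?z0p.
  rewrite mulmx_ord3 !mulmx_ord3 ![_^T _ _]mxE !mxE /=.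
  by field; rewrite b0p z0p.
Qed.

Lemma contact_structure_eigenbasis : phi_eigenbasis U g e3 phi e1 e2 e3.
Proof.
split=> //; first by move=> p Up; rewrite phi_e1.
(* Here [xi, e1] = 0 and [xi, e2] = (epsilon_1 / beta) e1, because delta_1 = alpha epsilon_1 / beta.
   So h e1 is half of [xi, e2], and h e2 is minus half of phi [xi, e2]. *)
exists (fun p => partial i1 epsilon p / (2 * beta p)) => p Up.
have b0p := b0 Up.
have D1 : \row_i partial i1 (fun q => e1 q 0 i) p = 0.
  apply/rowP; elim/ord3_ind; rewrite mxE [RHS]mxE.
  - rewrite (_ : (fun q => e1 q 0 i1) = alpha); last first.
      by apply/funext => q; rewrite frame1E.
    exact: (fun_of_x23_partial1 oU a23 Up).
  - rewrite (_ : (fun q => e1 q 0 i2) = beta); last first.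
      by apply/funext => q; rewrite frame1E.
    exact: (fun_of_x23_partial1 oU b23 Up).
  - rewrite (_ : (fun q => e1 q 0 i3) = fun=> 0); last first.
      by apply/funext => q; rewrite frame1E.
    exact: partial_cst.
have D2 : \row_i partial i1 (fun q => e2 q 0 i) p =
    (partial i1 epsilon p / beta p) *: e1 p.
  apply/rowP; elim/ord3_ind; rewrite mxE [RHS]mxE frame1E.
  - rewrite (_ : (fun q => e2 q 0 i1) = delta); last first.
      by apply/funext => q; rewrite frame2E.
    have sae := smooth_onM oU sa se.
    rewrite (partial_eq_on i1 oU deltaE Up).
    rewrite (partialD _ (smooth_on_div oU b0 sae sb) sF Up).
    rewrite (partial_div _ oU sae sb b0 Up) (partialM _ sa se Up).
    rewrite (fun_of_x23_partial1 oU a23 Up) (fun_of_x23_partial1 oU b23 Up).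
    by rewrite (fun_of_x23_partial1 oU F23 Up); field.
  - rewrite (_ : (fun q => e2 q 0 i2) = epsilon); last first.
      by apply/funext => q; rewrite frame2E.
    by field.
  - rewrite (_ : (fun q => e2 q 0 i3) = zeta); last first.
      by apply/funext => q; rewrite frame2E.
    by rewrite mulr0; exact: (fun_of_x23_partial1 oU z23 Up).
have D1N : \row_i partial i1 (fun q => (- e1 q) 0 i) p = 0.
  apply/rowP => i; rewrite mxE [RHS]mxE.
  rewrite (_ : (fun q => (- e1 q) 0 i) = (fun q => - (e1 q 0 i))); last first.
    by apply/funext => q; rewrite mxE.
  rewrite (partialN _ (smooth_frame1 oU sa sb 0 i) Up).
  by move/rowP: D1 => /(_ i); rewrite !mxE => ->; rewrite oppr0.
have refl3 q : U q -> e3 q = e3 q by [].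
rewrite /h_tensor /lie_derivative (lie_bracket_frame3 oU refl3 phi_e1 Up) D2.
rewrite (lie_bracket_frame3 oU refl3 phi_e2 Up) D1N /tensor_apply.
rewrite (lie_bracket_frame3 oU refl3 (fun q _ => erefl (e1 q)) Up) D1.
rewrite (lie_bracket_frame3 oU refl3 (fun q _ => erefl (e2 q)) Up) D2.
rewrite -scalemxAl -/(tensor_apply phi e1 p) phi_e1// mul0mx subr0 sub0r.
rewrite scalerN scaleNr !scalerA.
by rewrite (_ : 2^-1 * _ = partial i1 epsilon p / (2 * beta p)) //; field.
Qed.

End Sufficiency.

(** * Pointwise forms of the equation where F vanishes and where it does not *)

Section SolutionForms.
Set Implicit Arguments.
Unset Strict Implicit.
Variable R : realType.
Local Notation pt := 'rV[R]_3.
Implicit Types (U : set pt) (alpha beta zeta F : pt -> R) (p : pt).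

Lemma fun_of_x23_sub U V (f : pt -> R) : V `<=` U -> fun_of_x23 U f ->
  fun_of_x23 V f.
Proof. by move=> VU [f0 ff0]; exists f0 => p /VU; exact: ff0. Qed.

Lemma fun_of_x23_comp2 (op : R -> R -> R) U (f h : pt -> R) :
  fun_of_x23 U f -> fun_of_x23 U h -> fun_of_x23 U (fun p => op (f p) (h p)).
Proof.
move=> [f0 ff0] [h0 hh0]; exists (fun s t => op (f0 s t) (h0 s t)) => p Up.
by rewrite ff0// hh0.
Qed.

Lemma frame_eq_F_eq0 alpha beta zeta F p : zeta p != 0 -> F p = 0 ->
  frame_eq alpha beta zeta F p <->
  ratio_3 alpha beta p * zeta p = partial i2 F p - 2 / beta p.
Proof.
move=> z0 F0; rewrite /frame_eq F0 mul0r add0r expr2 mulrA -mulrBl.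
split=> [/eqP|->]; last by rewrite subrr mul0r.
by rewrite mulf_eq0 (negbTE z0) orbF subr_eq0 => /eqP.
Qed.

Lemma frame_eq_Riccati alpha beta zeta F p : F p != 0 ->
  frame_eq alpha beta zeta F p <->
  partial i2 zeta p = (partial i2 F p - 2 / beta p) / F p * zeta p
                      - ratio_3 alpha beta p / F p * zeta p ^+ 2.
Proof.
move=> F0; rewrite /frame_eq.
move: (partial i2 F p - 2 / beta p) (ratio_3 alpha beta p) (partial i2 zeta p).
move=> x r y; split=> [h|->]; last by field.
apply: (mulfI F0); rewrite -[LHS]subr0 -h.
by field.
Qed.

End SolutionForms.

Theorem mainTheorem3 (R : realType) (U : set 'rV[R]_3)
  (g : 'rV[R]_3 -> 'M[R]_3)
  (alpha beta delta epsilon zeta : 'rV[R]_3 -> R)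
  (U_open : open U) (U_small : x1_reducible U)
  (g_riemannian : riemannian_on U g)
  (alpha_smooth : smooth_on U alpha) (beta_smooth : smooth_on U beta)
  (delta_smooth : smooth_on U delta) (epsilon_smooth : smooth_on U epsilon)
  (zeta_smooth : smooth_on U zeta)
  (beta_zeta_neq0 : forall p, U p -> beta p * zeta p != 0)
  (frame_orthonormal : orthonormal_on U g
     (frame1 alpha beta) (frame2 delta epsilon zeta) (@frame3 R)) :
  ((exists eta xi phi,
      contact_metric_structure U g eta xi phi /\
      phi_eigenbasis U g xi phi
        (frame1 alpha beta) (frame2 delta epsilon zeta) (@frame3 R))
   <->
   ([/\ fun_of_x23 U alpha, fun_of_x23 U beta & fun_of_x23 U zeta] /\
    exists F : 'rV[R]_3 -> R,
      [/\ smooth_on U F, fun_of_x23 U F,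
          (forall p, U p -> delta p = alpha p * epsilon p / beta p + F p) &
          (forall p, U p -> frame_eq alpha beta zeta F p)]))
  /\
  (forall F : 'rV[R]_3 -> R,
     fun_of_x23 U alpha -> fun_of_x23 U beta -> fun_of_x23 U zeta ->
     smooth_on U F -> fun_of_x23 U F ->
     (forall p, U p -> delta p = alpha p * epsilon p / beta p + F p) ->
     [/\ (* points where F = 0 *)
         (forall p, U p -> F p = 0 ->
            (frame_eq alpha beta zeta F p <->
             ratio_3 alpha beta p * zeta p = partial i2 F p - 2 / beta p)),
         (* points where F <> 0: Riccati normal form *)
         (forall p, U p -> F p != 0 ->
            (frame_eq alpha beta zeta F p <->
             partial i2 zeta p =
               (partial i2 F p - 2 / beta p) / F p * zeta p
               - ratio_3 alpha beta p / F p * zeta p ^+ 2)),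
         (* its local solution, with antiderivatives P and Q in x^2 *)
         (forall a b : 'rV[R]_3,
            open_box a b `<=` U ->
            (forall p, open_box a b p -> F p != 0) ->
            (exists P, antiderivative_x2 (open_box a b)
                         (fun p => (beta p * F p)^-1) P) /\
            forall P, antiderivative_x2 (open_box a b)
                        (fun p => (beta p * F p)^-1) P ->
              (exists Q, antiderivative_x2 (open_box a b)
                 (fun p => expR (- 2 * P p) * ratio_3 alpha beta p) Q) /\
              forall Q, antiderivative_x2 (open_box a b)
                 (fun p => expR (- 2 * P p) * ratio_3 alpha beta p) Q ->
                ((forall p, open_box a b p -> frame_eq alpha beta zeta F p)
                 <->
                 exists K : R -> R,
                   smooth_on (open_box a b) (fun p => K (p 0 i3)) /\
                   forall p, open_box a b p ->
                     Q p - K (p 0 i3) != 0 /\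
                     zeta p = F p * (expR (- 2 * P p) / (Q p - K (p 0 i3))))) &
         (* the associated metric *)
         ((forall p, U p -> frame_eq alpha beta zeta F p) ->
          forall p, U p ->
            g p = assoc_metric alpha beta epsilon zeta F p /\
            \det (g p) = 1 / (beta p ^+ 2 * zeta p ^+ 2))]).
Proof.
have b0 p : U p -> beta p != 0.
  by move=> /beta_zeta_neq0; rewrite mulf_eq0 => /norP[].
have z0 p : U p -> zeta p != 0.
  by move=> /beta_zeta_neq0; rewrite mulf_eq0 => /norP[].
split.
  split=> [[eta [xi [phi [cms eig]]]]|[[a23 b23 z23] [F [sF F23 dE fe]]]].
    exact: (eigenbasis_necessary U_open U_small alpha_smooth beta_smooth
      delta_smooth epsilon_smooth zeta_smooth beta_zeta_neq0 cms eig).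
  exists (contact_form alpha beta zeta F), (@frame3 R),
    (contact_tensor alpha beta delta epsilon zeta); split.
    exact: (contact_structure_exists U_open g_riemannian alpha_smooth beta_smooth
      delta_smooth epsilon_smooth zeta_smooth sF beta_zeta_neq0
      frame_orthonormal a23 b23 z23 F23 dE fe).
  exact: (contact_structure_eigenbasis U_open alpha_smooth beta_smooth
    epsilon_smooth sF beta_zeta_neq0 frame_orthonormal a23 b23 z23 F23 dE).
move=> F a23 b23 z23 sF F23 dE; split.
- by move=> p Up F0; apply: frame_eq_F_eq0 => //; exact: z0.
- by move=> p Up F0; exact: frame_eq_Riccati.
- move=> a b VU F0; have oV := @open_box_open R a b.
  have Vs f : smooth_on U f -> smooth_on (open_box a b) f by exact: smooth_on_sub.
  have V23 f : fun_of_x23 U f -> fun_of_x23 (open_box a b) f.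
    exact: fun_of_x23_sub.
  have s1 : smooth_on (open_box a b) (fun p => (beta p * F p)^-1).
    apply: smooth_onV => // [p Vp|]; first by rewrite mulf_neq0 ?F0 ?b0//; exact: VU.
    by apply: smooth_onM => //; exact: Vs.
  split.
    apply: antiderivative_x2_exists => //.
    exact: (fun_of_x23_comp2 (fun x y => (x * y)^-1) (V23 _ b23) (V23 _ F23)).
  move=> P AP; have [sP P23 _] := AP; split.
    apply: antiderivative_x2_exists.
      apply: smooth_onM => //; last first.
        by apply/Vs/smooth_on_partial/smooth_on_div.
      by apply: smooth_on_expR => //; apply: smooth_onM => //; exact: smooth_on_cst.
    apply: (fun_of_x23_comp2 (fun x y => expR (- 2 * x) * y) P23).
    apply/V23/fun_of_x23_partial => //.
    exact: (fun_of_x23_comp2 (fun x y => x / y) a23 b23).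
  move=> Q AQ.
  apply: (frame_eq_solution (Vs _ beta_smooth) (Vs _ zeta_smooth) (Vs _ sF)
    (V23 _ z23) (V23 _ F23) _ _ F0 AP AQ) => p /VU; [exact: b0|exact: z0].
- move=> _ p Up; have [_ /(_ p Up)[gT _]] := g_riemannian.
  split.
    exact: (metric_eq_assoc_metric (b0 _ Up) (z0 _ Up) (dE _ Up) gT
      (frame_orthonormal _ Up)).
  exact: (det_metric (b0 _ Up) (z0 _ Up) (dE _ Up) gT (frame_orthonormal _ Up)).
Qed.
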